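(* Let $g:\mathbb{N}\to\mathbb{N}$ be a computable order with $\lim_n n/g(n)=0$. If a random real $z$ computes a $g$-fat set of incompressible strings, then $z\geq_T\emptyset'$.
   Context: $2^{<\omega}$ is the set of finite binary strings, $2^i$ the set of $i$-bit strings; reals are infinite binary sequences. $K$ is prefix-free Kolmogorov complexity. ''Random'' means Martin-Löf random; $\leq_T$ is Turing reducibility; $\emptyset'$ is the halting problem. An order is a nondecreasing unbounded function $g:\mathbb{N}\to\mathbb{N}$. A set $D\subseteq 2^{<\omega}$ is $g$-fat if $\max_{i\leq n}|D\cap 2^i|\geq g(n)$ for all $n$. A set $E$ of strings is a set of incompressible strings if $\sup_{\sigma\in E}(|\sigma|-K(\sigma))<\infty$. ''$z$ computes $D$'' means $D\leq_T z$. *)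

(* Defs.v *)
From Stdlib Require Cantor.
From mathcomp Require Import all_boot all_order all_algebra.
From mathcomp Require Import boolp classical_sets reals topology normedtype.
From mathcomp Require Import sequences.
Import Order.TTheory GRing.Theory Num.Theory.
Import numFieldNormedType.Exports.

Set Implicit Arguments.
Unset Strict Implicit.
Unset Printing Implicit Defensive.

Local Open Scope classical_set_scope.

Definition str := seq bool.
Definition real := nat -> bool.

Definition npair (a b : nat) : nat := Cantor.to_nat (a, b).
Definition nfst (n : nat) : nat := (Cantor.of_nat n).1.
Definition nsnd (n : nat) : nat := (Cantor.of_nat n).2.

(* Bijective base-2 numeration (least significant digit first), with digit 1
   for [false] and 2 for [true]: a computable bijection from strings to nat. *)
Fixpoint str_code (s : str) : nat :=
  if s is b :: s' then ((str_code s').*2 + b).+1 else 0.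

(* Unary partial recursive functions relative to an oracle, with Cantor pairs
   standing for tuples of arguments. *)
Inductive code : Type :=
  | Zero | Succ | Fst | Snd | Oracle
  | Pair of code & code
  | Comp of code & code
  | Prec of code & code
  | Mu of code.

(* Graph of h(a, 0) = F(a), h(a, m + 1) = G(a, (m, h(a, m))). *)
Fixpoint prec_graph (F G : nat -> nat -> Prop) (a m v : nat) : Prop :=
  if m is m'.+1 then
    exists2 u, prec_graph F G a m' u & G (npair a (npair m' u)) v
  else F a v.

(* [eval z c n v]: the function computed by [c] with oracle [z] is defined at
   [n], with value [v]. [Mu] requires convergence below the least zero. *)
Fixpoint eval (z : real) (c : code) (n v : nat) : Prop :=
  match c with
  | Zero => v = 0
  | Succ => v = n.+1
  | Fst => v = nfst n
  | Snd => v = nsnd n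
  | Oracle => v = z n
  | Pair c1 c2 => exists a b, [/\ eval z c1 n a, eval z c2 n b & v = npair a b]
  | Comp c1 c2 => exists2 m, eval z c2 n m & eval z c1 m v
  | Prec c1 c2 => prec_graph (eval z c1) (eval z c2) (nfst n) (nsnd n) v
  | Mu c1 => eval z c1 (npair n v) 0 /\
             forall i, i < v -> exists k, eval z c1 (npair n i) k.+1
  end.

(* Unrelativized computability is computability from the empty oracle. *)
Definition eval0 : code -> nat -> nat -> Prop := eval (fun=> false).

Definition computable_fun (g : nat -> nat) : Prop :=
  exists c, forall n, eval0 c n (g n).

Definition turing_le (A : set nat) (z : real) : Prop :=
  exists c, forall n, (A n -> eval z c n 1) /\ (~ A n -> eval z c n 0).

Definition str_turing_le (D : set str) (z : real) : Prop :=
  turing_le (str_code @` D) z.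

(* A bijective Goedel numbering of codes. *)
Fixpoint code_num (c : code) : nat :=
  match c with
  | Zero => 0
  | Succ => 1
  | Fst => 2
  | Snd => 3
  | Oracle => 4
  | Pair c1 c2 => 5 + 4 * npair (code_num c1) (code_num c2)
  | Comp c1 c2 => 6 + 4 * npair (code_num c1) (code_num c2)
  | Prec c1 c2 => 7 + 4 * npair (code_num c1) (code_num c2)
  | Mu c1 => 8 + 4 * code_num c1
  end.

Definition halting : set nat :=
  [set e | exists2 c, code_num c = e & exists v, eval0 c e v].

(* [runs M p s]: the machine [M], viewed as a partial computable function on
   strings, maps the program [p] to [s]. *)
Definition runs (M : code) (p s : str) : Prop :=
  eval0 M (str_code p) (str_code s).

Definition prefix_free_machine (M : code) : Prop :=
  forall p q s t, runs M p s -> runs M q t -> prefix p q -> p = q.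

(* The prefix-free machines that may serve as reference machine for [K]. *)
Definition optimal_machine (U : code) : Prop :=
  prefix_free_machine U /\
  forall M, prefix_free_machine M ->
    exists d, forall p s, runs M p s ->
      exists2 q, runs U q s & size q <= size p + d.

(* The default value 0 is never used when [U] is optimal. *)
Definition K (U : code) (s : str) : nat :=
  if pselect (exists k, `[< exists2 p, size p = k & runs U p s >]) is left e
  then ex_minn e else 0.

Definition incompressible (U : code) (E : set str) : Prop :=
  exists d, forall s, E s -> size s <= K U s + d.

(* The fraction of the [L]-bit strings that extend an element of [V]. The
   uniform measure of the open set of reals with a prefix in [V] is the
   supremum over [L] of these fractions: level [L] gives the measure of the
   part generated by the elements of [V] of length at most [L]. *)
Definition level_measure (V : set str) (L : nat) : rat :=
  (#|[pred t : L.-tuple bool | `[< exists2 s, V s & prefix s t >]]|%:R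
   / 2 ^+ L)%R.

Definition open_measure_le (V : set str) (q : rat) : Prop :=
  forall L, (level_measure V L <= q)%R.

Definition uniformly_ce (V : nat -> set str) : Prop :=
  exists c, forall n s, V n s <-> exists v, eval0 c (npair n (str_code s)) v.

Definition ML_test (V : nat -> set str) : Prop :=
  uniformly_ce V /\ forall n, open_measure_le (V n) (2 ^- n)%R.

Definition generated_open (V : set str) : set real :=
  [set z | exists n, V (mkseq z n)].

Definition ML_random (z : real) : Prop :=
  forall V, ML_test V -> ~ (\bigcap_n generated_open (V n)) z.

Definition order_fun (g : nat -> nat) : Prop :=
  {homo g : m n / m <= n} /\ forall k, exists n, k <= g n.

Definition fat (g : nat -> nat) (D : set str) : Prop :=
  forall n, g n <= \max_(i < n.+1) #|[pred t : i.-tuple bool | tval t \in D]|.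

(* Main.v *)
Require Import Defs.
From Stdlib Require Cantor.
From mathcomp Require Import all_boot all_order all_algebra.
From mathcomp Require Import boolp classical_sets reals topology normedtype.
From mathcomp Require Import sequences.
From mathcomp Require Import zify.
Import Order.TTheory GRing.Theory Num.Theory.
Import numFieldNormedType.Exports.

Set Implicit Arguments.
Unset Strict Implicit.
Unset Printing Implicit Defensive.

Local Open Scope classical_set_scope.

(** When [n] is seen to halt, at stage [t], consider the oracles [x] of length
    [t] from which the reduction has already enumerated, at some length
    [i < 2^l], at least [2^(3n+2+l)] strings; since [n / g n] tends to 0, there
    is a computable [l = l(n)] for which the given random [z] eventually becomes
    such an oracle.  A prefix-free machine can spend the programs
    [1^n 0 (i in l bits) r], with [r] of length [i - (2n+1+l)], on the strings of
    length [i], each of them then being compressed by [n] bits.  Choosing these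
    strings greedily hits the enumerated sets of all but a fraction [2^-(n+1)] of
    the oracles.  The missed oracles form a Martin-Loef test, which [z] passes,
    and a set of incompressible strings contains no string compressed by too
    many bits; hence for large [n] the oracle [z] is not ready when [n] is
    enumerated into the halting set.  So [z] decides the halting of [n]: wait
    until [z] is ready and look whether [n] has been seen to halt. *)

Local Notation eval := Defs.eval.

(** * Pairing and determinism of evaluation *)

Lemma nfstK a b : nfst (npair a b) = a.
Proof. by rewrite /nfst /npair Cantor.cancel_of_to. Qed.

Lemma nsndK a b : nsnd (npair a b) = b.
Proof. by rewrite /nsnd /npair Cantor.cancel_of_to. Qed.

Lemma npairK n : npair (nfst n) (nsnd n) = n.
Proof. by rewrite /npair /nfst /nsnd -surjective_pairing Cantor.cancel_to_of. Qed.

Lemma npair_inj a b a' b' : npair a b = npair a' b' -> a = a' /\ b = b'.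
Proof. by move=> e; rewrite -(nfstK a b) -{2}(nsndK a b) e nfstK nsndK. Qed.

Lemma leq_npair a b : a + b <= npair a b.
Proof. by have := Cantor.to_nat_non_decreasing a b; rewrite /npair; lia. Qed.

Lemma eval_fun z c n v v' : eval z c n v -> eval z c n v' -> v = v'.
Proof.
elim: c n v v' => [||||||||c IH] //=; do ?by move=> n v v' -> ->.
- move=> c1 IH1 c2 IH2 n v v' [a [b [ha hb ->]]] [a' [b' [ha' hb' ->]]].
  by rewrite (IH1 _ _ _ ha ha') (IH2 _ _ _ hb hb').
- move=> c1 IH1 c2 IH2 n v v' [m hm hv] [m' hm' hv'].
  by move: hv'; rewrite -(IH2 _ _ _ hm hm'); apply: IH1.
- move=> c1 IH1 c2 IH2 n; elim: (nsnd n) => [|m IHm] v v' /=; first exact: IH1.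
  move=> [u hu hv] [u' hu' hv'].
  by move: hv'; rewrite -(IHm _ _ hu hu'); apply: IH2.
- move=> n v v' [h0 h] [h0' h'].
  case: (ltngtP v v') => // hlt.
  + by have [k hk] := h' _ hlt; have := IH _ _ _ h0 hk.
  + by have [k hk] := h _ hlt; have := IH _ _ _ h0' hk.
Qed.

(** * Computable functions between encoded types *)

(** Only injectivity is asked: computing on a type constrains a code on the range of [enc] alone.
    Surjectivity is assumed separately where numbers have to be decoded. *)
Class encodable (T : Type) := Encodable
  { enc : T -> nat; enc_inj : forall x y, enc x = enc y -> x = y }.

#[export] Instance encodable_nat : encodable nat.
Proof. by exists id. Defined.

#[export] Instance encodable_bool : encodable bool.
Proof. by exists nat_of_bool; case; case. Defined.

#[export] Instance encodable_prod A B {eA : encodable A} {eB : encodable B} :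
  encodable (A * B).
Proof.
exists (fun p => npair (enc p.1) (enc p.2)).
by move=> [x y] [x' y'] /npair_inj /= [e e']; rewrite (enc_inj e) (enc_inj e').
Defined.

(** A nonempty sequence is encoded by a successor, so that emptiness is a zero test and the
    predecessor is the pair of head and tail. *)
Fixpoint enc_seq A (eA : encodable A) (s : seq A) : nat :=
  if s is x :: s' then (npair (enc x) (enc_seq eA s')).+1 else 0.

#[export] Instance encodable_seq A {eA : encodable A} : encodable (seq A).
Proof.
exists (enc_seq eA); elim=> [|x s IH] [|y t] //= [] /npair_inj.
by case=> e /IH ->; rewrite (enc_inj e).
Defined.

Section Computable.
Context (z : Defs.real).

(** Totality is built in, and the oracle is a parameter: the same closure properties serve the
    machine and the test, with the empty oracle, and the final reduction, with the random one. *)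
Variant cpt {A B : Type} {eA : encodable A} {eB : encodable B} (f : A -> B) : Prop :=
  Cpt c of forall a, eval z c (enc a) (enc (f a)).

Lemma cpt_ext A B {eA : encodable A} {eB : encodable B} (f g : A -> B) :
  f =1 g -> cpt f -> cpt g.
Proof. by move=> fg [c hc]; exists c => a; rewrite -fg. Qed.

Lemma cpt_id A {eA : encodable A} : cpt (fun a : A => a).
Proof.
(* No constructor is the identity; pairing the two projections gives it, since Cantor pairing is
   onto. *)
exists (Pair Fst Snd) => a /=; exists (nfst (enc a)), (nsnd (enc a)).
by rewrite npairK.
Qed.

Lemma cpt_comp A {eA : encodable A} B C {eB : encodable B} {eC : encodable C}
    (f : B -> C) (g : A -> B) :
  cpt f -> cpt g -> cpt (fun a => f (g a)).
Proof.
by move=> [c hc] [d hd]; exists (Comp c d) => a /=; exists (enc (g a)).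
Qed.

Lemma cpt_pair A {eA : encodable A} B C {eB : encodable B} {eC : encodable C}
    (f : A -> B) (g : A -> C) :
  cpt f -> cpt g -> cpt (fun a => (f a, g a)).
Proof.
move=> [c hc] [d hd]; exists (Pair c d) => a /=.
by exists (enc (f a)), (enc (g a)).
Qed.

Lemma cpt_fst A {eA : encodable A} B C {eB : encodable B} {eC : encodable C} (f : A -> B * C) :
  cpt f -> cpt (fun a => (f a).1).
Proof.
by move=> [c hc]; exists (Comp Fst c) => a; exists (enc (f a)); rewrite //= nfstK.
Qed.

Lemma cpt_snd A {eA : encodable A} B C {eB : encodable B} {eC : encodable C} (f : A -> B * C) :
  cpt f -> cpt (fun a => (f a).2).
Proof.
by move=> [c hc]; exists (Comp Snd c) => a; exists (enc (f a)); rewrite //= nsndK.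
Qed.

Lemma cpt_npair A {eA : encodable A} (f g : A -> nat) :
  cpt f -> cpt g -> cpt (fun a => npair (f a) (g a)).
Proof.
by move=> [c hc] [d hd]; exists (Pair c d) => a; exists (f a), (g a).
Qed.

Lemma cpt_nfst A {eA : encodable A} (f : A -> nat) : cpt f -> cpt (fun a => nfst (f a)).
Proof. by move=> [c hc]; exists (Comp Fst c) => a; exists (f a). Qed.

Lemma cpt_nsnd A {eA : encodable A} (f : A -> nat) : cpt f -> cpt (fun a => nsnd (f a)).
Proof. by move=> [c hc]; exists (Comp Snd c) => a; exists (f a). Qed.

Lemma cpt_S A {eA : encodable A} (f : A -> nat) : cpt f -> cpt (fun a => (f a).+1).
Proof. by move=> [c hc]; exists (Comp Succ c) => a; exists (f a). Qed.

Lemma cpt_const A {eA : encodable A} B {eB : encodable B} (b : B) : cpt (fun _ : A => b).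
Proof.
have [c hc] : exists c, forall n, eval z c n (enc b).
  elim: (enc b) => [|k [c hc]]; first by exists Zero.
  by exists (Comp Succ c) => n /=; exists k.
by exists c.
Qed.

Lemma cpt_nat_rect A {eA : encodable A} B {eB : encodable B} (base : A -> B)
    (step : A -> nat -> B -> B) (num : A -> nat) :
  cpt num -> cpt base -> cpt (fun p : A * (nat * B) => step p.1 p.2.1 p.2.2) ->
  cpt (fun a => nat_rect (fun=> B) (base a) (step a) (num a)).
Proof.
move=> [cn hn] [cb hb] [cs hs].
have [ci hi] := @cpt_id A eA.
exists (Comp (Prec cb cs) (Pair ci cn)) => a /=.
exists (npair (enc a) (num a)).
  by exists (enc a), (enc (num a)); split.
rewrite nfstK nsndK; elim: (num a) => [|m IHm] /=; first exact: hb.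
exists (enc (nat_rect (fun=> B) (base a) (step a) m)) => //.
exact: (hs (a, (m, _))).
Qed.

(* On an empty sequence, [h a] need not encode anything and [f] may diverge on
   it, hence a conditional whose second branch is not run unless [b a]. *)
Lemma cpt_guard A {eA : encodable A} B C {eB : encodable B} {eC : encodable C} (b : A -> bool)
    (base : A -> C) (h : A -> nat) (f : A -> B -> C) (k : A -> C) :
  cpt b -> cpt base -> cpt h -> cpt (fun p : A * B => f p.1 p.2) ->
  (forall a, if b a then exists2 y, h a = enc y & k a = f a y
             else k a = base a) ->
  cpt k.
Proof.
move=> [cb hb] [c0 h0] [ch hh] [cf hf] hk.
have [ci hi] := @cpt_id A eA.
(* A recursion of length [b a]: with length 0 only [c0] is run, with length 1 the step runs [cf] on
   the parameter, which is then the encoding of [(a, y)]. *)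
exists (Comp (Prec (Comp c0 Fst) (Comp cf Fst))
             (Pair (Pair ci ch) cb)) => a /=.
exists (npair (npair (enc a) (h a)) (b a)).
  by exists (npair (enc a) (h a)), (b a); split=> //; exists (enc a), (h a).
rewrite nfstK nsndK; move: (hk a); case: (b a) => [[y -> ->]|->] /=.
- exists (enc (base a)).
    by exists (enc a) => //; rewrite nfstK.
  exists (npair (enc a) (enc y)); first by rewrite nfstK.
  exact: (hf (a, y)).
- by exists (enc a) => //; rewrite nfstK.
Qed.

Ltac cpt_proj := repeat first
  [ refine cpt_id | refine (cpt_fst _) | refine (cpt_snd _) | refine (cpt_pair _ _) ].

Lemma cpt_if A {eA : encodable A} B {eB : encodable B} (b : A -> bool) (f g : A -> B) :
  cpt b -> cpt f -> cpt g -> cpt (fun a => if b a then f a else g a).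
Proof.
move=> hb hf hg.
apply: (cpt_guard (b := b) (base := g) (h := fun=> 0) (f := fun a (_ : nat) => f a)) => //.
- exact: cpt_const.
- refine (cpt_comp (f := f) hf _); cpt_proj.
- by move=> a; case: (b a) => //; exists 0.
Qed.

Lemma cpt_nat_rectE A {eA : encodable A} B {eB : encodable B} (base : A -> B)
    (step : A -> nat -> B -> B) (num : A -> nat) (f : A -> B) :
  cpt num -> cpt base -> cpt (fun p : A * (nat * B) => step p.1 p.2.1 p.2.2) ->
  (forall a, f a = nat_rect (fun=> B) (base a) (step a) (num a)) -> cpt f.
Proof.
by move=> hn hb hs fE; refine (cpt_ext _ (cpt_nat_rect hn hb hs)) => a; rewrite fE.
Qed.

Lemma cpt_predn A {eA : encodable A} (f : A -> nat) : cpt f -> cpt (fun a => (f a).-1).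
Proof.
move=> hf.
apply: (cpt_nat_rectE (base := (fun=> 0)) (step := (fun _ m _ => m)) (num := f)) => //.
- exact: cpt_const.
- cpt_proj.
- by move=> a; case: (f a).
Qed.

Lemma cpt_addn A {eA : encodable A}
    (f g : A -> nat) : cpt f -> cpt g -> cpt (fun a => f a + g a).
Proof.
move=> hf hg; apply: (cpt_nat_rectE (base := g) (step := (fun _ _ r => r.+1)) (num := f)) => //.
- refine (cpt_S _); cpt_proj.
- by move=> a; elim: (f a) => [|n IH] //=; rewrite addSn IH.
Qed.

Lemma cpt_subn A {eA : encodable A}
    (f g : A -> nat) : cpt f -> cpt g -> cpt (fun a => f a - g a).
Proof.
move=> hf hg; apply: (cpt_nat_rectE (base := f) (step := (fun _ _ r => r.-1)) (num := g)) => //.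
- refine (cpt_predn _); cpt_proj.
- by move=> a; elim: (g a) => [|n IH] /=; rewrite ?subn0 // subnS IH.
Qed.

Lemma cpt_muln A {eA : encodable A} (f g : A -> nat) :
  cpt f -> cpt g -> cpt (fun a => f a * g a).
Proof.
move=> hf hg.
apply: (cpt_nat_rectE (base := fun=> 0) (step := fun a _ r => g a + r) (num := f)) => //.
- exact: cpt_const.
- refine (cpt_addn _ _); last by cpt_proj.
  refine (cpt_comp (f := g) hg _); cpt_proj.
- by move=> a; elim: (f a) => [|n IH] //=; rewrite mulSn IH.
Qed.

Lemma cpt_enc A {eA : encodable A} B {eB : encodable B} (s : A -> B) :
  cpt s -> cpt (fun a => enc (s a)).
Proof. by case=> c hc; exists c. Qed.

Lemma cpt_nat_of_bool A {eA : encodable A}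
    (b : A -> bool) : cpt b -> cpt (fun a => nat_of_bool (b a)).
Proof. by case=> c hc; exists c. Qed.

Lemma cpt_isS A {eA : encodable A} (f : A -> nat) : cpt f -> cpt (fun a => f a != 0).
Proof.
move=> hf.
apply: (cpt_nat_rectE (base := (fun=> false)) (step := (fun _ _ _ => true)) (num := f)) => //.
- exact: cpt_const.
- exact: cpt_const.
- by move=> a; case: (f a).
Qed.

Lemma cpt_negb A {eA : encodable A} (b : A -> bool) : cpt b -> cpt (fun a => ~~ b a).
Proof.
move=> hb; refine (cpt_ext _ (cpt_if hb (cpt_const false) (cpt_const true))) => a.
by case: (b a).
Qed.

Lemma cpt_andb A {eA : encodable A}
    (b c : A -> bool) : cpt b -> cpt c -> cpt (fun a => b a && c a).
Proof.
move=> hb hc; refine (cpt_ext _ (cpt_if hb hc (cpt_const false))) => a.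
by case: (b a).
Qed.

Lemma cpt_orb A {eA : encodable A}
    (b c : A -> bool) : cpt b -> cpt c -> cpt (fun a => b a || c a).
Proof.
move=> hb hc; refine (cpt_ext _ (cpt_if hb (cpt_const true) hc)) => a.
by case: (b a).
Qed.

Lemma cpt_leq A {eA : encodable A}
    (f g : A -> nat) : cpt f -> cpt g -> cpt (fun a => f a <= g a).
Proof.
move=> hf hg; refine (cpt_ext _ (cpt_negb (cpt_isS (cpt_subn hf hg)))) => a.
by rewrite negbK.
Qed.

Lemma cpt_eq A {eA : encodable A} (T : eqType) {eT : encodable T} (f g : A -> T) :
  cpt f -> cpt g -> cpt (fun a => f a == g a).
Proof.
move=> /cpt_enc hf /cpt_enc hg.
refine (cpt_ext _ (cpt_andb (cpt_leq hf hg) (cpt_leq hg hf))) => a.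
rewrite -eqn_leq; apply/eqP/eqP => [|-> //]; exact: enc_inj.
Qed.

Lemma cpt_cons A {eA : encodable A} T {eT : encodable T} (f : A -> T) (s : A -> seq T) :
  cpt f -> cpt s -> cpt (fun a => f a :: s a).
Proof.
by move=> hf hs; have [c hc] := cpt_S (cpt_npair (cpt_enc hf) (cpt_enc hs)); exists c.
Qed.

Lemma cpt_match_seq A {eA : encodable A} T B {eT : encodable T} {eB : encodable B}
    (s : A -> seq T)
    (f : A -> B) (g : A -> T -> seq T -> B) :
  cpt s -> cpt f -> cpt (fun p : A * (T * seq T) => g p.1 p.2.1 p.2.2) ->
  cpt (fun a => if s a is x :: t then g a x t else f a).
Proof.
move=> hs hf hg.
apply: (cpt_guard (b := fun a => enc (s a) != 0) (base := f)
  (h := fun a => (enc (s a)).-1) (f := fun a y => g a y.1 y.2)) => //.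
- exact: (cpt_isS (cpt_enc hs)).
- exact: (cpt_predn (cpt_enc hs)).
- by move=> a; case: (s a) => // x t; exists (x, t).
Qed.

(** The fold is an iteration that consumes one entry at a time and idles on the empty sequence;
    [enc (s a)] bounds the length, so it serves as the number of iterations. *)
Lemma cpt_foldl A {eA : encodable A} T B {eT : encodable T} {eB : encodable B}
    (F : A -> B -> T -> B) (b : A -> B) (s : A -> seq T) :
  cpt (fun p : A * (B * T) => F p.1 p.2.1 p.2.2) -> cpt b -> cpt s ->
  cpt (fun a => foldl (F a) (b a) (s a)).
Proof.
move=> hF hb hs.
pose step a (st : seq T * B) :=
  if st.1 is x :: t then (t, F a st.2 x) else st.
have h : cpt (fun a => nat_rect (fun=> (seq T * B)%type) (s a, b a)
                 (fun _ st => step a st) (enc (s a))).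
  apply: (cpt_nat_rect (base := fun a => (s a, b a))
            (step := fun a _ st => step a st) (num := fun a => enc (s a))).
  - exact: cpt_enc.
  - exact: cpt_pair.
  - refine (cpt_match_seq _ _ _).
    + cpt_proj.
    + cpt_proj.
    + refine (cpt_pair _ _); first by cpt_proj.
      apply: (cpt_comp (f := fun p : A * (B * T) => F p.1 p.2.1 p.2.2)
               (g := fun p : A * (nat * (seq T * B)) * (T * seq T) =>
                  (p.1.1, (p.1.2.2.2, p.2.1))) hF).
      cpt_proj.
refine (cpt_ext _ (cpt_snd h)) => a; move: (b a) => {hb h} b0.
have : size (s a) <= enc (s a).
  elim: (s a) => [|x t IH] //=; rewrite ltnS; apply: leq_trans IH _.
  exact: leq_trans (leq_addl _ _) (leq_npair _ _).
rewrite (_ : nat_rect _ _ _ _ = iter (enc (s a)) (step a) (s a, b0)); last first.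
  by elim: (enc _) => //= n ->.
move: (enc (s a)) => N; elim: N (s a) b0 => [|n IH] s0 c; first by case: s0.
by rewrite iterSr; case: s0 => [|x t] le_t; rewrite IH.
Qed.

Lemma cpt_rev A {eA : encodable A} T {eT : encodable T} (s : A -> seq T) :
  cpt s -> cpt (fun a => rev (s a)).
Proof.
move=> hs.
have h : cpt (fun a => foldl (fun r x => x :: r) [::] (s a)).
  apply: (cpt_foldl (F := fun _ r x => x :: r) (b := fun=> [::])) => //.
  - refine (cpt_cons _ _); first by cpt_proj.
    by cpt_proj.
  - exact: cpt_const.
apply: cpt_ext h => a; rewrite -[s a]revK.
by rewrite foldl_rev revK; elim: (rev (s a)) => //= x t ->.
Qed.

Lemma cpt_foldr A {eA : encodable A} T B {eT : encodable T} {eB : encodable B}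
    (F : A -> T -> B -> B) (b : A -> B) (s : A -> seq T) :
  cpt (fun p : A * (B * T) => F p.1 p.2.2 p.2.1) -> cpt b -> cpt s ->
  cpt (fun a => foldr (F a) (b a) (s a)).
Proof.
move=> hF hb /cpt_rev hs.
have := cpt_foldl (F := fun a r x => F a x r) (b := b) hF hb hs.
by apply: cpt_ext => a; rewrite foldl_rev.
Qed.

Definition cpt2 {A B C} {eA : encodable A} {eB : encodable B} {eC : encodable C}
    (f : A -> B -> C) :=
  cpt (fun p : A * B => f p.1 p.2).

Definition cpt3 {A B C D} {eA : encodable A} {eB : encodable B} {eC : encodable C}
    {eD : encodable D} (f : A -> B -> C -> D) :=
  cpt (fun p : A * (B * C) => f p.1 p.2.1 p.2.2).

Lemma cpt_comp2 X A B C {eX : encodable X} {eA : encodable A} {eB : encodable B}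
    {eC : encodable C} (f : A -> B -> C) (a : X -> A) (b : X -> B) :
  cpt2 f -> cpt a -> cpt b -> cpt (fun x => f (a x) (b x)).
Proof. move=> hf ha hb; exact (cpt_comp hf (cpt_pair ha hb)). Qed.

Lemma cpt_comp3 X A B C D {eX : encodable X} {eA : encodable A} {eB : encodable B}
    {eC : encodable C} {eD : encodable D} (f : A -> B -> C -> D)
    (a : X -> A) (b : X -> B) (c : X -> C) :
  cpt3 f -> cpt a -> cpt b -> cpt c -> cpt (fun x => f (a x) (b x) (c x)).
Proof. move=> hf ha hb hc; exact (cpt_comp hf (cpt_pair ha (cpt_pair hb hc))). Qed.

End Computable.

Arguments cpt_id {z A eA}.
Arguments cpt_const {z A eA B eB} b.

(** Both hooks of [cpt_auto] are redefined as further closure properties become available. *)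
Ltac cpt_user := fail.

Ltac cpt_hook := fail.

Ltac cpt_auto := repeat (cbv beta; first
  [ eassumption | refine cpt_id | refine (cpt_const _)
  | match goal with
    | h : cpt _ ?f |- _ => refine (cpt_comp (f := f) h _)
    | h : cpt2 _ ?f |- _ => refine (cpt_comp2 (f := f) h _ _)
    | h : cpt3 _ ?f |- _ => refine (cpt_comp3 (f := f) h _ _ _)
    end
  | cpt_user | cpt_hook
  | refine (cpt_npair _ _) | refine (cpt_nfst _) | refine (cpt_nsnd _)
  | refine (cpt_fst _) | refine (cpt_snd _) | refine (cpt_pair _ _)
  | refine (cpt_S _) | refine (cpt_predn _) | refine (cpt_addn _ _)
  | refine (cpt_subn _ _) | refine (cpt_muln _ _) | refine (cpt_nat_of_bool _)
    | refine (cpt_negb _) | refine (cpt_andb _ _) | refine (cpt_orb _ _)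
  | refine (cpt_if _ _ _) | refine (cpt_leq _ _) | refine (cpt_eq _ _)
  | refine (cpt_cons _ _) | refine (cpt_match_seq _ _ _)
  | refine (cpt_foldr _ _ _) | refine (cpt_rev _) | refine (cpt_nat_rect _ _ _) ]).

(** * Computable operations on sequences and numbers *)

Section Derived.
Context {z : Defs.real}.
Local Notation cpt := (cpt z).
Local Notation cpt2 := (cpt2 z).

Lemma cpt_size A T {eA : encodable A} {eT : encodable T} (s : A -> seq T) :
  cpt s -> cpt (fun a => size (s a)).
Proof.
move=> hs.
have h : cpt (fun a => foldr (fun _ n => n.+1) 0 (s a)) by cpt_auto.
by refine (cpt_ext _ h) => a; elim: (s a) => //= x t ->.
Qed.

Lemma cpt_cat A T {eA : encodable A} {eT : encodable T} (s t : A -> seq T) :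
  cpt s -> cpt t -> cpt (fun a => s a ++ t a).
Proof.
move=> hs ht.
have h : cpt (fun a => foldr (fun x r => x :: r) (t a) (s a)) by cpt_auto.
by refine (cpt_ext _ h) => a; elim: (s a) => //= x r ->.
Qed.

Lemma cpt_map A T B {eA : encodable A} {eT : encodable T} {eB : encodable B}
    (f : A -> T -> B) (s : A -> seq T) :
  cpt2 f -> cpt s -> cpt (fun a => map (f a) (s a)).
Proof.
move=> hf hs.
have h : cpt (fun a => foldr (fun x r => f a x :: r) [::] (s a)) by cpt_auto.
by refine (cpt_ext _ h) => a; elim: (s a) => //= x t ->.
Qed.

Lemma cpt_has A T {eA : encodable A} {eT : encodable T}
    (P : A -> T -> bool) (s : A -> seq T) :
  cpt2 P -> cpt s -> cpt (fun a => has (P a) (s a)).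
Proof.
move=> hP hs.
have h : cpt (fun a => foldr (fun x r => P a x || r) false (s a)) by cpt_auto.
by refine (cpt_ext _ h) => a; elim: (s a) => //= x t ->.
Qed.

Lemma cpt_all A T {eA : encodable A} {eT : encodable T}
    (P : A -> T -> bool) (s : A -> seq T) :
  cpt2 P -> cpt s -> cpt (fun a => all (P a) (s a)).
Proof.
move=> hP hs.
have h : cpt (fun a => foldr (fun x r => P a x && r) true (s a)) by cpt_auto.
by refine (cpt_ext _ h) => a; elim: (s a) => //= x t ->.
Qed.

Lemma cpt_count A T {eA : encodable A} {eT : encodable T}
    (P : A -> T -> bool) (s : A -> seq T) :
  cpt2 P -> cpt s -> cpt (fun a => count (P a) (s a)).
Proof.
move=> hP hs.
have h : cpt (fun a => foldr (fun x r => P a x + r) 0 (s a)) by cpt_auto.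
by refine (cpt_ext _ h) => a; elim: (s a) => //= x t ->.
Qed.

Lemma cpt_drop A T {eA : encodable A} {eT : encodable T} (n : A -> nat) (s : A -> seq T) :
  cpt n -> cpt s -> cpt (fun a => drop (n a) (s a)).
Proof.
move=> hn hs.
have h : cpt (fun a => nat_rect (fun=> seq T) (s a)
    (fun _ r => if r is _ :: t then t else r) (n a)) by cpt_auto.
refine (cpt_ext _ h) => a.
elim: (n a) => [|m IH] /=; first by rewrite drop0.
by rewrite IH -add1n -drop_drop; case: (drop m _) => //= x t; rewrite drop0.
Qed.

Lemma cpt_take A T {eA : encodable A} {eT : encodable T} (n : A -> nat) (s : A -> seq T) :
  cpt n -> cpt s -> cpt (fun a => take (n a) (s a)).
Proof.
move=> hn hs.
have hs' := cpt_size hs.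
have h : cpt (fun a => rev (drop (size (s a) - n a) (rev (s a)))).
  by refine (cpt_rev (cpt_drop _ _)); cpt_auto.
by refine (cpt_ext _ h) => a; rewrite -{1}(size_rev (s a)) -take_rev revK.
Qed.

Lemma cpt_prefix A (T : eqType) {eA : encodable A} {eT : encodable T} (s t : A -> seq T) :
  cpt s -> cpt t -> cpt (fun a => prefix (s a) (t a)).
Proof.
move=> hs ht.
have h : cpt (fun a => take (size (s a)) (t a) == s a).
  by refine (cpt_eq (cpt_take (cpt_size hs) ht) hs).
by refine (cpt_ext _ h) => a; rewrite prefixE.
Qed.

Lemma cpt_nth A T {eA : encodable A} {eT : encodable T} (d : T) (s : A -> seq T)
    (n : A -> nat) :
  cpt s -> cpt n -> cpt (fun a => nth d (s a) (n a)).
Proof.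
move=> hs hn; have hd := cpt_drop hn hs.
have h : cpt (fun a => if drop (n a) (s a) is x :: _ then x else d) by cpt_auto.
refine (cpt_ext _ h) => a.
by rewrite -[in RHS](addn0 (n a)) -nth_drop; case: (drop _ _).
Qed.

Lemma cpt_iota A {eA : encodable A} (n : A -> nat) :
  cpt n -> cpt (fun a => iota 0 (n a)).
Proof.
move=> hn.
have h : cpt (fun a => rev (nat_rect (fun=> seq nat) [::] (fun m r => m :: r) (n a))).
  by cpt_auto.
refine (cpt_ext _ h) => a; elim: (n a) => // m IH.
by rewrite -[in RHS]addn1 iotaD -IH /= rev_cons cats1 add0n.
Qed.

Lemma cpt_expn A {eA : encodable A} (m n : A -> nat) :
  cpt m -> cpt n -> cpt (fun a => m a ^ n a).
Proof.
move=> hm hn.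
have h : cpt (fun a => nat_rect (fun=> nat) 1 (fun _ r => m a * r) (n a)) by cpt_auto.
by refine (cpt_ext _ h) => a; elim: (n a) => //= k ->; rewrite expnS.
Qed.

Lemma cpt_odd A {eA : encodable A} (n : A -> nat) : cpt n -> cpt (fun a => odd (n a)).
Proof.
move=> hn.
have h : cpt (fun a => nat_rect (fun=> bool) false (fun _ r => ~~ r) (n a)) by cpt_auto.
by refine (cpt_ext _ h) => a; elim: (n a) => //= k ->.
Qed.

Lemma cpt_half A {eA : encodable A} (n : A -> nat) : cpt n -> cpt (fun a => (n a)./2).
Proof.
move=> hn.
have h : cpt (fun a => nat_rect (fun=> nat) 0 (fun m r => odd m + r) (n a)).
  refine (cpt_nat_rect (step := fun _ m r => odd m + r) hn (cpt_const _) _).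
  refine (cpt_addn (cpt_nat_of_bool (cpt_odd _)) _); cpt_auto.
by refine (cpt_ext _ h) => a; elim: (n a) => //= k ->; rewrite uphalf_half.
Qed.

End Derived.

Ltac cpt_hook ::= first
  [ refine (cpt_size _) | refine (cpt_cat _ _) | refine (cpt_map _ _)
  | refine (cpt_has _ _) | refine (cpt_all _ _) | refine (cpt_count _ _)
  | refine (cpt_nth _ _ _) | refine (cpt_take _ _) | refine (cpt_prefix _ _) | refine (cpt_iota _)
  | refine (cpt_expn _ _) | refine (cpt_odd _) | refine (cpt_half _) ].

Lemma cpt_oracle z : cpt z z.
Proof. by exists Oracle. Qed.

Lemma cpt_mkseq z : cpt z (fun n => mkseq z n).
Proof. by have hz := cpt_oracle z; rewrite /mkseq; cpt_auto. Qed.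

(** The empty oracle answers every query by 0, so replacing queries by [Zero] makes an unrelativized
    computation run under any oracle. *)
Fixpoint erase_oracle (c : code) : code :=
  match c with
  | Oracle => Zero
  | Pair c1 c2 => Pair (erase_oracle c1) (erase_oracle c2)
  | Comp c1 c2 => Comp (erase_oracle c1) (erase_oracle c2)
  | Prec c1 c2 => Prec (erase_oracle c1) (erase_oracle c2)
  | Mu c1 => Mu (erase_oracle c1)
  | _ => c
  end.

Lemma eval_erase_oracle z c n v : eval0 c n v -> eval z (erase_oracle c) n v.
Proof.
rewrite /eval0; elim: c n v => //=.
- by move=> c1 IH1 c2 IH2 n v [a [b [/IH1 ha /IH2 hb ->]]]; exists a, b.
- by move=> c1 IH1 c2 IH2 n v [m /IH2 hm /IH1 hv]; exists m.
- move=> c1 IH1 c2 IH2 n; elim: (nsnd n) => [|m IHm] v /=; first exact: IH1.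
  by move=> [u /IHm hu /IH2 hv]; exists u.
- move=> c IH n v [/IH h0 h]; split=> // i /h [k /IH hk].
  by exists k.
Qed.

Lemma computable_fun_cpt z g : computable_fun g -> cpt z g.
Proof. by case=> c hc; exists (erase_oracle c) => n; apply: eval_erase_oracle. Qed.

(** * Unbounded search *)

Section Search.
Context (z : Defs.real) {A B : Type} {eA : encodable A} {eB : encodable B}.
Variables (Q : A -> nat -> bool) (f : A -> nat -> B).
Hypotheses (hQ : cpt2 z Q) (hf : cpt2 z f).

(** [Mu] finds the least zero, hence the negation of [Q]. The equivalence also covers divergence,
    which matters where the domain of the code is the object of interest. *)
Lemma search_code :
  exists c, forall a v, eval z c (enc a) v <->
    Q a v /\ forall i, i < v -> ~~ Q a i.
Proof.
have [c hc] : cpt2 z (fun a n => ~~ Q a n) by rewrite /cpt2; cpt_auto.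
exists (Mu c) => a v /=; split=> [[h0 h]|[hv h]]; last first.
  split; first by have := hc (a, v); rewrite /= hv.
  by move=> i /h ni; exists 0; have := hc (a, i); rewrite /= ni.
have hE n k : eval z c (npair (enc a) n) k -> k = ~~ Q a n.
  by move=> hk; apply: (eval_fun hk); apply: (hc (a, n)).
split; first by have := hE _ _ h0; case: (Q a v).
by move=> i /h [k /hE]; case: (Q a i).
Qed.

Lemma cpt_ex_minn (ex : forall a, exists n, Q a n) :
  cpt z (fun a => ex_minn (ex a)).
Proof.
have [c hc] := search_code; exists c => a.
apply/hc; case: ex_minnP => n Qn le_n; split=> // i lt_in.
by apply/negP => /le_n; rewrite leqNgt lt_in.
Qed.

Lemma partial_search_code :
  exists c, forall a v, eval z c (enc a) v <->
    exists t, [/\ Q a t, forall i, i < t -> ~~ Q a i & v = enc (f a t)].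
Proof.
have [c hc] := search_code; have [d hd] := hf.
have [e he] := @cpt_id z A eA.
exists (Comp d (Pair e c)) => a v /=; split.
  move=> [m [x [t [hx /hc [Qt ht] ->]]]] hv.
  exists t; split=> //; have hx' := he a.
  by move: hv; rewrite -(eval_fun hx' hx) => hv; apply: (eval_fun hv); apply: (hd (a, t)).
move=> [t [Qt ht ->]]; exists (npair (enc a) t).
  by exists (enc a), t; split=> //; apply/hc.
exact: (hd (a, t)).
Qed.

End Search.

(** * Binary strings and their numbering *)

Definition decode_step (st : nat * str) : nat * str :=
  if st.1 != 0 then ((st.1).-1./2, odd (st.1).-1 :: st.2) else st.

(** The code itself is a sufficient number of steps: each step strictly lowers a nonzero code.
    Digits come out least significant first, hence the reversal. *)
Definition str_decode (n : nat) : str := rev (iter n decode_step (n, [::])).2.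

Lemma str_codeK : cancel str_code str_decode.
Proof.
move=> s; rewrite /str_decode.
suff h k r : str_code s <= k ->
    iter k decode_step (str_code s, r) = (0, catrev s r) by rewrite h // revK.
elim: s k r => [|b s IH] k r; first by move=> _; elim: k => //= k ->.
case: k => // k le_k; rewrite iterSr /decode_step [str_code _]/= -/decode_step /=.
have half_code : (((str_code s).*2 + b)./2 = str_code s)%N.
  by rewrite halfD doubleK odd_double; case: b {le_k}; rewrite /= ?addn0.
rewrite half_code oddD odd_double oddb IH //.
by move: le_k => /=; lia.
Qed.

Lemma str_code_inj : injective str_code.
Proof. exact: can_inj str_codeK. Qed.

Fixpoint strs (n : nat) : seq str :=
  if n is m.+1 then map (cons true) (strs m) ++ map (cons false) (strs m)
  else [:: [::]].

Definition leading_ones (p : str) : nat :=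
  foldr (fun (b : bool) r => if b then r.+1 else 0) 0 p.

Section Strings.
Context {z : Defs.real} {A : Type} {eA : encodable A}.

Lemma cpt_double (n : A -> nat) : cpt z n -> cpt z (fun a => (n a).*2).
Proof.
move=> hn; have h : cpt z (fun a => n a + n a) by cpt_auto.
by refine (cpt_ext _ h) => a; rewrite addnn.
Qed.

Lemma cpt_str_decode (n : A -> nat) : cpt z n -> cpt z (fun a => str_decode (n a)).
Proof.
move=> hn; rewrite /str_decode.
have h : cpt z (fun a => nat_rect (fun=> (nat * str)%type) (n a, [::])
    (fun _ => decode_step) (n a)) by rewrite /decode_step; cpt_auto.
have h' : cpt z (fun a => iter (n a) decode_step (n a, [::])).
  by refine (cpt_ext _ h) => a; move: (_, _) => st; elim: (n a) => //= k ->.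
by cpt_auto.
Qed.

Lemma cpt_leading_ones (p : A -> str) : cpt z p -> cpt z (fun a => leading_ones (p a)).
Proof. by move=> hp; rewrite /leading_ones; cpt_auto. Qed.

Lemma cpt_strs (n : A -> nat) : cpt z n -> cpt z (fun a => strs (n a)).
Proof.
move=> hn.
have h : cpt z (fun a => nat_rect (fun=> seq str) [:: [::]]
    (fun _ r => map (cons true) r ++ map (cons false) r) (n a)) by cpt_auto.
by refine (cpt_ext _ h) => a; elim: (n a) => //= k ->.
Qed.

End Strings.

Ltac cpt_user ::= first
  [ refine (cpt_double _) | refine (cpt_str_decode _)
  | refine (cpt_leading_ones _) | refine (cpt_strs _) ].

Lemma cpt_str_code z A {eA : encodable A} (s : A -> str) :
  cpt z s -> cpt z (fun a => str_code (s a)).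
Proof.
move=> hs.
have h : cpt z (fun a => foldr (fun (b : bool) r => (r.*2 + b).+1) 0 (s a)).
  by cpt_auto.
by refine (cpt_ext _ h).
Qed.

Lemma mem_strs n s : (s \in strs n) = (size s == n).
Proof.
elim: n s => [|n IH] [|b s] //=; rewrite mem_cat.
  by apply/negbTE; rewrite negb_or; apply/andP; split; apply/mapP => -[].
rewrite eqSS -IH; apply/orP/idP => [[]/mapP[t ht [_ ->]] //|hs].
by case: b; [left|right]; apply: map_f.
Qed.

Lemma strs_uniq n : uniq (strs n).
Proof.
elim: n => //= n IH; rewrite cat_uniq !map_inj_uniq ?IH //; try by move=> ? ? [].
by rewrite andbT /=; apply/hasPn => _ /mapP[s _ ->]; apply/mapP => -[].
Qed.

Lemma size_strs n : size (strs n) = 2 ^ n.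
Proof. by elim: n => //= n IH; rewrite size_cat !size_map IH expnS mul2n addnn. Qed.

(** Links counting in lists, which is computable, to the cardinalities of sets of tuples in [fat]
    and [level_measure]. *)
Lemma count_strs n (P : pred str) :
  count P (strs n) = #|[pred t : n.-tuple bool | P t]|.
Proof.
have /permP -> : perm_eq (strs n) (map val (enum {: n.-tuple bool})).
  apply: uniq_perm; rewrite ?strs_uniq // ?(map_inj_uniq val_inj) ?enum_uniq //.
  move=> s; rewrite mem_strs; apply/idP/mapP => [hs|[t _ ->]]; last by rewrite size_tuple.
  by exists (Tuple hs); rewrite ?mem_enum.
rewrite count_map cardE -size_filter enumT; congr size; exact: eq_filter.
Qed.

(** * Derivations as certificates of convergence *)

(* A pair [(e, (n, v))] stands for the assertion that the code with number [e]
   maps [n] to [v]. *)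
Definition fact := (nat * (nat * nat))%type.

(** A query is answered only inside the finite oracle [x], so a fact derived from [x] stays
    derivable from every extension of [x]. *)
Definition base_fact (x : str) (f : fact) : bool :=
  let: (e, (n, v)) := f in
  [|| (e == 0) && (v == 0), (e == 1) && (v == n.+1), (e == 2) && (v == nfst n),
      (e == 3) && (v == nsnd n) |
      [&& e == 4, n < size x & v == nth false x n]].

Definition pair_fact (L : seq fact) (f : fact) : bool :=
  has (fun f1 => has (fun f2 : fact =>
    [&& f.1 == 5 + 4 * npair f1.1 f2.1, f1.2.1 == f.2.1, f2.2.1 == f.2.1 &
        f.2.2 == npair f1.2.2 f2.2.2]) L) L.

Definition comp_fact (L : seq fact) (f : fact) : bool :=
  has (fun f1 => has (fun f2 : fact =>
    [&& f.1 == 6 + 4 * npair f1.1 f2.1, f2.2.1 == f.2.1, f1.2.1 == f2.2.2 &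
        f1.2.2 == f.2.2]) L) L.

(** At 0 the step code is not run, so [L] need not mention its number [e2]; it is sought below
    [f.1], which exceeds both components of the pair. The same search supplies [e1] in
    [precS_fact]. *)
Definition prec0_fact (L : seq fact) (f : fact) : bool :=
  has (fun f1 : fact => has (fun e2 =>
    [&& f.1 == 7 + 4 * npair f1.1 e2, nsnd f.2.1 == 0,
        f1.2.1 == nfst f.2.1 & f1.2.2 == f.2.2]) (iota 0 f.1)) L.

Definition precS_fact (L : seq fact) (f : fact) : bool :=
  has (fun f1 => has (fun f2 : fact => has (fun e1 =>
    [&& f.1 == 7 + 4 * npair e1 f2.1, 0 < nsnd f.2.1, f1.1 == f.1,
        f1.2.1 == npair (nfst f.2.1) (nsnd f.2.1).-1,
        f2.2.1 == npair (nfst f.2.1) (npair (nsnd f.2.1).-1 f1.2.2) &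
        f2.2.2 == f.2.2]) (iota 0 f.1)) L) L.

Definition mu_fact (L : seq fact) (f : fact) : bool :=
  has (fun f1 : fact =>
    [&& f.1 == 8 + 4 * f1.1, f1.2.1 == npair f.2.1 f.2.2, f1.2.2 == 0 &
        all (fun i => has (fun f2 : fact =>
          [&& f2.1 == f1.1, f2.2.1 == npair f.2.1 i & f2.2.2 != 0]) L)
        (iota 0 f.2.2)]) L.

Definition justified (x : str) (L : seq fact) (f : fact) : bool :=
  [|| base_fact x f, pair_fact L f, comp_fact L f, prec0_fact L f,
      precS_fact L f | mu_fact L f].

(** The premises of an entry stand behind it, which excludes circular derivations. *)
Fixpoint valid (x : str) (L : seq fact) : bool :=
  if L is f :: L' then justified x L' f && valid x L' else true.

Lemma justified_mono x y L L' f :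
  prefix x y -> {subset L <= L'} -> justified x L f -> justified y L' f.
Proof.
move=> xy LL'.
have hsub (P Q : fact -> bool) : (forall f, P f -> Q f) -> has P L -> has Q L'.
  by move=> PQ /hasP[u /LL' uL /PQ Qu]; apply/hasP; exists u.
have hsub0 (T : eqType) (P Q : T -> bool) s : (forall f, P f -> Q f) -> has P s -> has Q s.
  by move=> PQ /hasP[u uL /PQ Qu]; apply/hasP; exists u.
case/or4P => [h|h|h|/or3P[h|h|h]]; apply/or4P; [constructor 1|constructor 2|constructor 3|
  constructor 4|constructor 4|constructor 4].
- case: f h => e [n v] /or4P[h|h|h|/orP[h|h]]; apply/or4P; [constructor 1|constructor 2|constructor 3|
  constructor 4; apply/orP; left|constructor 4; apply/orP; right] => //.
  case/prefixP: xy => w ->.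
  case/and3P: h => -> hn /eqP ->; rewrite size_cat nth_cat hn eqxx /=.
  by rewrite (leq_trans hn) ?leq_addr.
- by apply: (hsub) h => f1; apply: (hsub).
- by apply: (hsub) h => f1; apply: (hsub).
- by apply/or3P; constructor 1; apply: (hsub) h.
- by apply/or3P; constructor 2; apply: (hsub) h => f1; apply: (hsub).
- apply/or3P; constructor 3; apply: (hsub) h => f1 /and4P[-> -> -> /allP h] /=.
  by apply/allP => i /h; apply: (hsub).
Qed.

Lemma valid_mono x y L : prefix x y -> valid x L -> valid y L.
Proof.
move=> xy; elim: L => //= f L IH /andP[hf /IH ->]; rewrite andbT.
exact: justified_mono hf.
Qed.

Lemma valid_cat x L L' : valid x L -> valid x L' -> valid x (L ++ L').
Proof.
move=> hL hL'; elim: L hL => //= f L IH /andP[hf /IH ->]; rewrite andbT.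
by apply: justified_mono hf; rewrite ?prefix_refl // => u uL; rewrite mem_cat uL.
Qed.

Section InterpreterComputability.
Context {z : Defs.real} {A : Type} {eA : encodable A}.
Variables (x : A -> str) (L : A -> seq fact) (f : A -> fact).
Hypotheses (hx : cpt z x) (hL : cpt z L) (hf : cpt z f).

Lemma cpt_base_fact : cpt z (fun a => base_fact (x a) (f a)).
Proof.
have h : cpt z (fun a => 
  [|| ((f a).1 == 0) && ((f a).2.2 == 0), ((f a).1 == 1) && ((f a).2.2 == (f a).2.1.+1),
   ((f a).1 == 2) && ((f a).2.2 == nfst (f a).2.1),
      ((f a).1 == 3) && ((f a).2.2 == nsnd (f a).2.1) |
      [&& (f a).1 == 4, (f a).2.1 < size (x a) &
       (f a).2.2 == nth false (x a) (f a).2.1]]) by cpt_auto.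
by refine (cpt_ext _ h) => a; rewrite /base_fact; case: (f a) => e [n v].
Qed.

Lemma cpt_pair_fact : cpt z (fun a => pair_fact (L a) (f a)).
Proof. by rewrite /pair_fact; cpt_auto. Qed.

Lemma cpt_comp_fact : cpt z (fun a => comp_fact (L a) (f a)).
Proof. by rewrite /comp_fact; cpt_auto. Qed.

Lemma cpt_prec0_fact : cpt z (fun a => prec0_fact (L a) (f a)).
Proof. by rewrite /prec0_fact; cpt_auto. Qed.

Lemma cpt_precS_fact : cpt z (fun a => precS_fact (L a) (f a)).
Proof. by rewrite /precS_fact; cpt_auto. Qed.

Lemma cpt_mu_fact : cpt z (fun a => mu_fact (L a) (f a)).
Proof. by rewrite /mu_fact; cpt_auto. Qed.

End InterpreterComputability.

Lemma cpt_valid z : cpt2 z valid.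
Proof.
(* The justification of an entry refers to the whole tail, so the fold rebuilds the tail next to the
   verdict. *)
pose F (x : str) (f : fact) (st : bool * seq fact) :=
  (justified x st.2 f && st.1, f :: st.2).
have hF : cpt3 z F.
  rewrite /cpt3 /F; refine (cpt_pair (cpt_andb _ _) _); cycle 1; try by cpt_auto.
  refine (cpt_orb (cpt_base_fact _ _) (cpt_orb (cpt_pair_fact _ _)
    (cpt_orb (cpt_comp_fact _ _) (cpt_orb (cpt_prec0_fact _ _)
    (cpt_orb (cpt_precS_fact _ _) (cpt_mu_fact _ _)))))); cpt_auto.
have h : cpt z (fun p : str * seq fact => (foldr (F p.1) (true, [::]) p.2).1).
  refine (cpt_fst (cpt_foldr (F := fun p => F p.1) _ _ _)); cycle 1; try by cpt_auto.
refine (cpt_ext _ h) => -[x L] /=.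
suff -> : foldr (F x) (true, [::]) L = (valid x L, L) by [].
by elim: L => //= f L ->.
Qed.

(** * Decoding of numbers and enumeration of the certificates *)

Section Decode.
Context {T : Type} {eT : encodable T}.
Hypothesis enc_surj : forall n, exists x : T, enc x = n.

Definition decode (n : nat) : T := projT1 (cid (enc_surj n)).

Lemma decodeK n : enc (decode n) = n.
Proof. by rewrite /decode; case: cid. Qed.

Lemma encK x : decode (enc x) = x.
Proof. exact: enc_inj (decodeK _). Qed.

(** Although [decode] is obtained by choice, on encodings it is the identity of the natural
    numbers. *)
Lemma cpt_decode z : cpt z decode.
Proof. by have [c hc] := @cpt_id z nat _; exists c => n; rewrite decodeK. Qed.

End Decode.

Lemma enc_prod_surj A B {eA : encodable A} {eB : encodable B} :
  (forall n, exists x : A, enc x = n) -> (forall n, exists y : B, enc y = n) ->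
  forall n, exists p : A * B, enc p = n.
Proof.
move=> hA hB n; have [x hx] := hA (nfst n); have [y hy] := hB (nsnd n).
by exists (x, y); rewrite /= hx hy npairK.
Qed.

Lemma enc_seq_surj A {eA : encodable A} :
  (forall n, exists x : A, enc x = n) -> forall n, exists s : seq A, enc s = n.
Proof.
move=> hA; elim/ltn_ind => -[|n] IH; first by exists [::].
have [x hx] := hA (nfst n); have [|s hs] := IH (nsnd n).
  by rewrite ltnS -{2}(npairK n); exact: leq_trans (leq_addl _ _) (leq_npair _ _).
exists (x :: s); rewrite (_ : enc _ = (npair (enc x) (enc s)).+1) //.
by rewrite hx hs npairK.
Qed.

Lemma enc_nat_surj n : exists m : nat, enc m = n.
Proof. by exists n. Qed.

Definition enc_nat2_surj := enc_prod_surj enc_nat_surj enc_nat_surj.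

Definition certificate : nat -> seq fact :=
  decode (enc_seq_surj (enc_prod_surj enc_nat_surj enc_nat2_surj)).

(** Since [true_fact] is vacuous at a number that belongs to no code, this is what turns a proved
    fact into an actual convergent computation. *)
Lemma code_num_surj e : exists c, code_num c = e.
Proof.
elim/ltn_ind: e => e IH.
case: (ltnP e 5) => [|le5e].
  case: e {IH} => [|[|[|[|[|//]]]]] _.
  - by exists Zero.
  - by exists Succ.
  - by exists Fst.
  - by exists Snd.
  - by exists Oracle.
pose q := (e - 5) %/ 4; pose r := (e - 5) %% 4.
have eE : e = 5 + r + 4 * q by rewrite /q /r; lia.
have lt_r : r < 4 by rewrite /r ltn_mod.
have hq : nfst q + nsnd q <= q by rewrite -{3}(npairK q) leq_npair.
have [|c1 hc1] := IH (nfst q); first by lia.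
have [|c2 hc2] := IH (nsnd q); first by lia.
have [|c hc] := IH q; first by lia.
have hp : npair (code_num c1) (code_num c2) = q by rewrite hc1 hc2 npairK.
case: r lt_r eE => [|[|[|[|//]]]] _ eE.
- by exists (Pair c1 c2); rewrite /= hp; lia.
- by exists (Comp c1 c2); rewrite /= hp; lia.
- by exists (Prec c1 c2); rewrite /= hp; lia.
- by exists (Mu c); rewrite /= hc; lia.
Qed.

Lemma justified_base x L f : base_fact x f -> justified x L f.
Proof. by rewrite /justified => ->; rewrite ?orbT. Qed.

Lemma justified_pair x L f : pair_fact L f -> justified x L f.
Proof. by rewrite /justified => ->; rewrite ?orbT. Qed.

Lemma justified_comp x L f : comp_fact L f -> justified x L f.
Proof. by rewrite /justified => ->; rewrite ?orbT. Qed.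

Lemma justified_prec0 x L f : prec0_fact L f -> justified x L f.
Proof. by rewrite /justified => ->; rewrite ?orbT. Qed.

Lemma justified_precS x L f : precS_fact L f -> justified x L f.
Proof. by rewrite /justified => ->; rewrite ?orbT. Qed.

Lemma justified_mu x L f : mu_fact L f -> justified x L f.
Proof. by rewrite /justified => ->; rewrite ?orbT. Qed.

(** * Soundness and completeness of certificates *)

Section Correctness.
Variable z : Defs.real.

Definition true_fact (f : fact) : Prop :=
  forall c, code_num c = f.1 -> eval z c f.2.1 f.2.2.

Lemma prec_graphS F G a m v u :
  prec_graph F G a m u -> G (npair a (npair m u)) v -> prec_graph F G a m.+1 v.
Proof. by move=> hu hv; exists u. Qed.

(** From 5 on, the residue of a code number modulo 4 identifies the constructor, and pairing is
    injective; hence each rule matches exactly one clause of [eval]. *)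
Lemma justified_sound k L f :
  (forall f', f' \in L -> true_fact f') -> justified (mkseq z k) L f -> true_fact f.
Proof.
move=> hL; case: f => e [n v].
have hL' e' n' v' : (e', (n', v')) \in L -> forall c, code_num c = e' -> eval z c n' v'.
  by move=> /hL.
case/or4P => [|||/or3P[]].
- case/or4P => [/andP[/eqP-> /eqP->]|/andP[/eqP-> /eqP->]|/andP[/eqP-> /eqP->]|
    /orP[/andP[/eqP-> /eqP->]|/and3P[/eqP-> ltn /eqP->]]] [] //=; try by move=> *; lia.
  by rewrite nth_mkseq // -(size_mkseq z k).
- case/hasP => -[e1 [n1 v1]] h1 /hasP[[e2 [n2 v2]] h2] /= /and4P[/eqP-> /eqP<- /eqP E /eqP->].
  case=> //=; try by move=> *; lia.
  move=> c1 c2 hc; have /npair_inj[] : npair (code_num c1) (code_num c2) = npair e1 e2 by lia.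
  move=> {}/(hL' _ _ _ h1) hv1 {}/(hL' _ _ _ h2) hv2.
  by exists v1, v2; split=> //; rewrite -E.
- case/hasP => -[e1 [n1 v1]] h1 /hasP[[e2 [n2 v2]] h2] /= /and4P[/eqP-> /eqP<- /eqP E /eqP<-].
  case=> //=; try by move=> *; lia.
  move=> c1 c2 hc; have /npair_inj[] : npair (code_num c1) (code_num c2) = npair e1 e2 by lia.
  move=> {}/(hL' _ _ _ h1) hv1 {}/(hL' _ _ _ h2) hv2.
  by exists v2 => //; rewrite -E.
- case/hasP => -[e1 [n1 v1]] h1 /hasP[e2 _] /= /and4P[/eqP-> /eqP n0 /eqP E /eqP<-].
  case=> //=; try by move=> *; lia.
  move=> c1 c2 hc; have /npair_inj[] : npair (code_num c1) (code_num c2) = npair e1 e2 by lia.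
  by move=> {}/(hL' _ _ _ h1) hv1 _; rewrite n0 /= -E.
- case/hasP => -[e1 [n1 v1]] h1 /hasP[[e2 [n2 v2]] h2] /hasP[e3 _] /=.
  case/and5P => [/eqP eE n0 /eqP e1E /eqP n1E] /andP[/eqP n2E /eqP<-].
  move=> c hc; move: (hc); rewrite eE; case: c hc => //=; try by move=> *; lia.
  move=> c1 c2 hc hc'.
  have /npair_inj[_] : npair (code_num c1) (code_num c2) = npair e3 e2 by lia.
  move=> {}/(hL' _ _ _ h2); rewrite n2E => hv2.
  have := hL' _ _ _ h1 (Prec c1 c2); rewrite /= e1E => /(_ hc).
  rewrite n1E nfstK nsndK => hv1; rewrite -(prednK n0).
  exact: prec_graphS hv1 hv2.
- case/hasP => -[e1 [n1 v1]] h1 /= /and4P[/eqP-> /eqP n1E /eqP v1E /allP hlt].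
  case=> //=; try by move=> *; lia.
  move=> c hc; have {}hc : code_num c = e1 by lia.
  split; first by have := hL' _ _ _ h1 c hc; rewrite n1E v1E.
  move=> i lt_iv; have := hlt i; rewrite mem_iota add0n lt_iv.
  move=> /(_ isT) /hasP[[e2 [n2 v2]] h2 /=].
  case/and3P => [/eqP e2E /eqP n2E v2_neq0].
  exists v2.-1; rewrite prednK ?lt0n // -n2E; apply: (hL' _ _ _ h2).
  by rewrite e2E.
Qed.

Lemma valid_sound k L f : valid (mkseq z k) L -> f \in L -> true_fact f.
Proof.
elim: L f => //= f L IH f' /andP[hf hL]; rewrite inE => /orP[/eqP->|]; last exact: IH.
by apply: justified_sound hf => f''; apply: IH.
Qed.

Definition provable (c : code) (n v : nat) : Prop :=
  exists k L, valid (mkseq z k) L /\ (code_num c, (n, v)) \in L.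

Lemma prefix_mkseq j k : j <= k -> prefix (mkseq z j) (mkseq z k).
Proof.
move=> le_jk; rewrite prefixE size_mkseq /mkseq -map_take.
by rewrite take_iota (minn_idPl le_jk).
Qed.

Lemma valid_mkseq k k' L : k <= k' -> valid (mkseq z k) L -> valid (mkseq z k') L.
Proof. by move=> le_k; apply: valid_mono; apply: prefix_mkseq. Qed.

(** Finitely many certificates are merged by taking the longest oracle prefix and concatenating the
    lists. *)
Lemma valid_all (I : eqType) (s : seq I) (P : I -> fact -> Prop) :
  (forall i, i \in s -> exists k L, valid (mkseq z k) L /\ exists2 f, f \in L & P i f) ->
  exists k L, valid (mkseq z k) L /\ forall i, i \in s -> exists2 f, f \in L & P i f.
Proof.
elim: s => [|i s IH] h; first by exists 0, [::].
have [k [L [hL [f fL Pf]]]] := h _ (mem_head i s).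
have [|k' [L' [hL' h']]] := IH; first by move=> j js; apply: h; rewrite inE js orbT.
exists (maxn k k'), (L ++ L'); split.
  apply: valid_cat.
  - by apply: valid_mkseq hL; rewrite leq_maxl.
  - by apply: valid_mkseq hL'; rewrite leq_maxr.
move=> j; rewrite inE => /orP[/eqP->|/h'[f' fL' Pf']].
  by exists f => //; rewrite mem_cat fL.
by exists f' => //; rewrite mem_cat fL' orbT.
Qed.

(** One rule of inference: the certificates of the premises are merged and the conclusion is put in
    front. The prefix is lengthened beyond [n] so that a query at [n] is covered. *)
Lemma provable_step (fs : seq fact) c n v :
  (forall f, f \in fs -> exists k L, valid (mkseq z k) L /\ f \in L) ->
  (forall k L, {subset fs <= L} -> n < k -> justified (mkseq z k) L (code_num c, (n, v))) ->
  provable c n v.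
Proof.
move=> hfs hj.
have [|k [L [hL fsL]]] := @valid_all _ fs eq.
  by move=> f /hfs[k [L [hL fL]]]; exists k, L; split=> //; exists f.
exists (maxn n.+1 k), ((code_num c, (n, v)) :: L); split; last by rewrite mem_head.
rewrite /= (valid_mkseq _ hL) ?leq_maxr // andbT.
by apply: hj; rewrite ?leq_maxl // => f /fsL[f' f'L ->].
Qed.

Lemma eval_provable c n v : eval z c n v -> provable c n v.
Proof.
elim: c n v => /=.
- move=> n v ->; apply: (@provable_step [::]) => [f|k L _ _]; first by rewrite in_nil.
  by apply: justified_base.
- move=> n v ->; apply: (@provable_step [::]) => [f|k L _ _]; first by rewrite in_nil.
  by apply: justified_base; apply/or4P; constructor 2; rewrite !eqxx.
- move=> n v ->; apply: (@provable_step [::]) => [f|k L _ _]; first by rewrite in_nil.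
  by apply: justified_base; apply/or4P; constructor 3; rewrite !eqxx.
- move=> n v ->; apply: (@provable_step [::]) => [f|k L _ _]; first by rewrite in_nil.
  by apply: justified_base; apply/or4P; constructor 4; rewrite !eqxx.
- move=> n v ->; apply: (@provable_step [::]) => [f|k L _ lt_n]; first by rewrite in_nil.
  apply: justified_base; apply/or4P; constructor 4; apply/orP; right.
  by rewrite size_mkseq lt_n nth_mkseq ?eqxx.
- move=> c1 IH1 c2 IH2 n _ [a [b [/IH1 h1 /IH2 h2 ->]]].
  apply: (@provable_step [:: (code_num c1, (n, a)); (code_num c2, (n, b))]).
    by move=> f; rewrite !inE => /orP[]/eqP->.
  move=> k L fL _; apply: justified_pair.
  apply/hasP; exists (code_num c1, (n, a)); first by apply: fL; rewrite !inE eqxx.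
  apply/hasP; exists (code_num c2, (n, b)); first by apply: fL; rewrite !inE eqxx orbT.
  by rewrite /= !eqxx.
- move=> c1 IH1 c2 IH2 n v [m /IH2 h2 /IH1 h1].
  apply: (@provable_step [:: (code_num c1, (m, v)); (code_num c2, (n, m))]).
    by move=> f; rewrite !inE => /orP[]/eqP->.
  move=> k L fL _; apply: justified_comp.
  apply/hasP; exists (code_num c1, (m, v)); first by apply: fL; rewrite !inE eqxx.
  apply/hasP; exists (code_num c2, (n, m)); first by apply: fL; rewrite !inE eqxx orbT.
  by rewrite /= !eqxx.
- move=> c1 IH1 c2 IH2 n v; rewrite -{3}(npairK n).
  have hnum : npair (code_num c1) (code_num c2) < code_num (Prec c1 c2) by rewrite /=; lia.
  elim: (nsnd n) v => [|m IHm] v /=.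
    move=> /IH1 h1.
    apply: (@provable_step [:: (code_num c1, (nfst n, v))]).
      by move=> f; rewrite !inE => /eqP->.
    move=> k L fL _; apply: justified_prec0.
    apply/hasP; exists (code_num c1, (nfst n, v)); first by apply: fL; rewrite !inE eqxx.
    apply/hasP; exists (code_num c2); last by rewrite /= nsndK nfstK !eqxx.
    rewrite mem_iota /= add0n; apply: leq_ltn_trans hnum.
    exact: leq_trans (leq_addl _ _) (leq_npair _ _).
  move=> [u /IHm hu /IH2 h2].
  apply: (@provable_step [:: (code_num (Prec c1 c2), (npair (nfst n) m, u));
      (code_num c2, (npair (nfst n) (npair m u), v))]).
    by move=> f; rewrite !inE => /orP[]/eqP->.
  move=> k L fL _; apply: justified_precS.
  apply/hasP; exists (code_num (Prec c1 c2), (npair (nfst n) m, u)).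
    by apply: fL; rewrite !inE eqxx.
  apply/hasP; exists (code_num c2, (npair (nfst n) (npair m u), v)).
    by apply: fL; rewrite !inE eqxx orbT.
  apply/hasP; exists (code_num c1); last by rewrite /= !nsndK !nfstK !eqxx.
  rewrite mem_iota /= add0n; apply: leq_ltn_trans hnum.
  exact: leq_trans (leq_addr _ _) (leq_npair _ _).
- move=> c IH n v [/IH h0 h].
  (* A single function collects the predecessors of the nonzero values below [v]; beyond [v] it
     takes the default 0. *)
  have /choice[u hu] i : exists k, i < v -> provable c (npair n i) k.+1.
    have [lt_iv|] := ltnP i v; last by exists 0.
    by have [k /IH hk] := h _ lt_iv; exists k.
  apply: (@provable_step ((code_num c, (npair n v, 0)) ::
      [seq (code_num c, (npair n i, (u i).+1)) | i <- iota 0 v])).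
    move=> f; rewrite inE => /orP[/eqP->//|/mapP[i]]; rewrite mem_iota => hi ->.
    exact: hu.
  move=> k L fL _; apply: justified_mu.
  apply/hasP; exists (code_num c, (npair n v, 0)); first by apply: fL; rewrite mem_head.
  rewrite /= !eqxx /=; apply/allP => i hi.
  apply/hasP; exists (code_num c, (npair n i, (u i).+1)); last by rewrite /= !eqxx.
  by apply: fL; rewrite inE; apply/orP; right; apply/mapP; exists i.
Qed.

End Correctness.

(* Stage [t] of the enumeration of the facts that hold relative to the oracles
   extending [x]: the first [t] certificates are inspected. *)
Definition proved (x : str) (t : nat) (P : pred fact) : bool :=
  has (fun w => valid x (certificate w) && has P (certificate w)) (iota 0 t).

Lemma cpt_proved z A {eA : encodable A} (x : A -> str) (t : A -> nat)
    (P : A -> fact -> bool) :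
  cpt z x -> cpt z t -> cpt2 z P -> cpt z (fun a => proved (x a) (t a) (P a)).
Proof.
move=> hx ht hP; have hv := cpt_valid z.
have hc : cpt z certificate := cpt_decode _ z.
rewrite /proved; refine (cpt_has _ _); last by cpt_auto.
refine (cpt_andb _ _); last by cpt_auto.
by refine (cpt_comp2 hv _ _); cpt_auto.
Qed.

Lemma proved_mono (x y : str) t u (P Q : pred fact) :
  prefix x y -> t <= u -> (forall f, P f -> Q f) -> proved x t P -> proved y u Q.
Proof.
move=> xy le_tu PQ /hasP[w]; rewrite mem_iota => /= lt_w /andP[hv /hasP[f fw Pf]].
apply/hasP; exists w; first by rewrite mem_iota; apply: leq_trans le_tu.
rewrite (valid_mono xy hv) /=; apply/hasP; exists f => //; exact: PQ.
Qed.

Lemma proved_sound z k t P :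
  proved (mkseq z k) t P -> exists2 f, P f & true_fact z f.
Proof.
case/hasP => w _ /andP[hv /hasP[f fw Pf]]; exists f => //.
exact: valid_sound hv fw.
Qed.

(** Prefix length and stage are the same [t], since later the length of an oracle string is its
    stage. The bound makes the prefix long enough and puts the index of the certificate below
    [t]. *)
Lemma proved_complete z c n v (P : pred fact) :
  eval z c n v -> P (code_num c, (n, v)) ->
  exists t0, forall t, t0 <= t -> proved (mkseq z t) t P.
Proof.
move=> /eval_provable[k [L [hL fL]]] Pf.
exists (maxn k (enc L).+1) => t; rewrite geq_max => /andP[le_k lt_L].
apply/hasP; exists (enc L); first by rewrite mem_iota.
rewrite /certificate encK (valid_mkseq le_k hL) /=.
by apply/hasP; exists (code_num c, (n, v)).
Qed.

(** * Greedy choice of the strings to compress *)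

(** Double counting of the pairs related by [P]. *)
Lemma sum_count (S T : Type) (P : T -> S -> bool) (s : seq S) (Y : seq T) :
  \sum_(y <- Y) count (P y) s = \sum_(x <- s) count (P^~ x) Y.
Proof.
elim: Y => [|y Y IH] /=; first by rewrite big_nil big1.
rewrite big_cons IH big_split /=; congr (_ + _).
by rewrite -sum1_count big_mkcond.
Qed.

(** Averaging: were every element of [s] below the mean, summing over [s] would contradict the
    double count. *)
Lemma popular_element (T : Type) (P : T -> str -> bool) (s : seq str) (Y : seq T) G :
  0 < size s -> all (fun y => G <= count (P y) s) Y ->
  exists2 x, x \in s & G * size Y <= size s * count (P^~ x) Y.
Proof.
move=> s_gt0 hY; apply: contrapT => hno.
have hlt x : x \in s -> size s * count (P^~ x) Y < G * size Y.
  by move=> xs; rewrite ltnNge; apply/negP => hle; apply: hno; exists x.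
have le1 : G * size Y <= \sum_(x <- s) count (P^~ x) Y.
  rewrite -sum_count; elim: Y hY {hno hlt} => [|y Y IH] /=; first by rewrite muln0.
  by move=> /andP[hy /IH hY]; rewrite big_cons mulnS leq_add.
have lt2 : size s * \sum_(x <- s) count (P^~ x) Y < size s * (G * size Y).
  rewrite big_distrr /= -[X in _ < X * _](sum1_size s) big_distrl /=.
  elim: s s_gt0 hlt {hno hY le1} => // x s IH _.
  set N := size (x :: s) => hlt; under [X in _ < X]eq_bigr do rewrite mul1n.
  rewrite !big_cons.
  have le_tail : \sum_(j <- s) N * count (P^~ j) Y <= \sum_(i <- s) G * size Y.
    rewrite big_seq [X in _ <= X]big_seq; apply: leq_sum => j js.
    by rewrite ltnW // hlt // inE js orbT.
  by rewrite -addSn leq_add // hlt // mem_head.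
by move: lt2; rewrite ltn_mul2l s_gt0 /= ltnNge le1.
Qed.

(* Each greedy choice removes a fraction at least [G / size s] of the elements
   not hit yet; the bound is the integer form of
   [(1 - G / N) ^ k <= 1 / (1 + k G / N)]. *)
Lemma greedy_hitting (T : Type) (P : T -> str -> bool) (s : seq str) (Y : seq T) G k :
  0 < size s -> all (fun y => G <= count (P y) s) Y ->
  exists F : seq str, [/\ size F = k, {subset F <= s} &
    count (fun y => ~~ has (P y) F) Y * (size s + k * G) <= size Y * size s].
Proof.
move=> s_gt0 hY; elim: k => [|k [F [szF Fs hF]]].
  by exists [::]; rewrite addn0 leq_mul2r count_size orbT.
pose Y' := seq.filter (fun y => ~~ has (P y) F) Y.
have hY' : all (fun y => G <= count (P y) s) Y'.
  by rewrite /Y'; elim: Y hY {hF Y'} => //= y Y IH /andP[hy /IH hY]; case: ifP => //= _; rewrite hy.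
have [x xs hx] := popular_element s_gt0 hY'.
exists (x :: F); split; first by rewrite /= szF.
  by move=> u; rewrite inE => /orP[/eqP->//|/Fs].
rewrite -size_filter -/Y' in hF.
have -> : count (fun y => ~~ has (P y) (x :: F)) Y = count (predC (P^~ x)) Y'.
  by rewrite /Y' count_filter; apply: eq_count => y /=; rewrite negb_or.
have hC := count_predC (P^~ x) Y'.
apply: leq_trans hF; move: hx hC; move: (count _ Y') (count _ Y') (size Y') => h r R hx hC.
(* What remains is [r * G <= h * (size s + k * G)], a consequence of [G * (h + r) <= size s * h]. *)
by rewrite -hC mulSn in hx *; nia.
Qed.

Lemma count_fibers (T : Type) (Q : pred T) (lev : T -> nat) m (s : seq T) :
  (forall x, Q x -> lev x < m) ->
  count Q s = \sum_(i < m) count (fun x => Q x && (lev x == i)) s.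
Proof.
move=> hQ; elim: s => [|x s IH] /=; first by rewrite big1.
rewrite big_split /= -IH; congr (_ + _).
case Qx: (Q x) => /=; last by rewrite big1.
rewrite (bigD1 (Ordinal (hQ _ Qx))) //= eqxx big1 // => i.
by rewrite -val_eqE /= eq_sym => /negbTE ->.
Qed.

(** Lengths stay below [2 ^ l] so that [l] bits of a program can name one. *)
Definition rich (l G : nat) (P : str -> bool) : bool :=
  has (fun i => G <= count P (strs i)) (iota 0 (2 ^ l)).

(* [A] lists descriptions [(p, s)]: program [p], starting with [1^n 0],
   describes [s] with [n] bits less than its length. *)
Definition good_descriptions (n t : nat) (B : str -> bool) (P : str -> str -> bool)
    (A : seq (str * str)) : bool :=
  [&& all (fun d => prefix (nseq n true ++ [:: false]) d.1 &&
                    (size d.1 + n <= size d.2)) A,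
      all (fun d => all (fun d' => prefix d.1 d'.1 ==> (d == d')) A) A &
      count (fun x => B x && ~~ has (fun d => P x d.2) A) (strs t) * 2 ^ n.+1
        <= 2 ^ t].

Lemma mem_zip (S T : eqType) (s : seq S) (t : seq T) u :
  u \in zip s t -> u.1 \in s /\ u.2 \in t.
Proof.
elim: s t => [|x s IH] [|y t] //=; rewrite !inE => /orP[/eqP->|/IH[-> ->]].
  by rewrite !eqxx.
by rewrite !orbT.
Qed.

Lemma zip_functional (S T : eqType) (s : seq S) (t : seq T) u v :
  uniq s -> u \in zip s t -> v \in zip s t -> u.1 = v.1 -> u = v.
Proof.
elim: s t => [|x s IH] [|y t] //= /andP[xs us]; rewrite !inE.
move=> /orP[/eqP->|ut] /orP[/eqP->|vt] //=.
- by move=> xv; case/negP: xs; rewrite xv; case: (mem_zip vt).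
- by move=> ux; case/negP: xs; rewrite -ux; case: (mem_zip ut).
- exact: IH ut vt.
Qed.

Lemma prefix_catl (s u v : str) : prefix (s ++ u) (s ++ v) = prefix u v.
Proof. by elim: s => //= b s ->; rewrite eqxx. Qed.

Lemma prefix_cat_eqsize (s t u v : str) :
  size s = size t -> prefix (s ++ u) (t ++ v) -> s = t /\ prefix u v.
Proof.
elim: s t => [|b s IH] [|c t] //= [/IH{}IH] /andP[/eqP-> /IH[-> ->]] //.
Qed.

(** The rich oracles are sorted by the least length at which they are rich, and the greedy choice is
    made separately for each length. Each class loses at most a fraction [2^-(n+1)], hence so does
    the union. *)
Lemma exists_good_descriptions n l t (P : str -> str -> bool) :
  exists A, good_descriptions n t
    (fun x => rich l (2 ^ (3 * n + 2 + l)) (P x)) P A.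
Proof.
(* With [r] of length [i - a] a program has length [n + 1 + l + (i - a) = i - n], exactly [n] bits
   below [i]. *)
set G := 2 ^ _; pose a := 2 * n + 1 + l; pose m := 2 ^ l.
(* If [x] is not rich, [lev x] takes the value [m]. *)
pose lev x := find (fun i => G <= count (P x) (strs i)) (iota 0 m).
pose Y i := seq.filter (fun x => lev x == i) (strs t).
have hlev x : lev x < m -> G <= count (P x) (strs (lev x)).
  move=> lt_m.
  have := @nth_find _ 0 (fun i => G <= count (P x) (strs i)) (iota 0 m).
  by rewrite has_find size_iota -/(lev x) nth_iota // => /(_ lt_m).
(* As many strings as there are tails [r]; none when [i] is too short to be compressed. *)
pose k i := if a <= i then 2 ^ (i - a) else 0.
have /choice[F hF] i : exists F : seq str, i < m ->
    [/\ size F = k i, {subset F <= strs i} &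
     count (fun x => ~~ has (P x) F) (Y i) * 2 ^ n.+1 <= size (Y i)].
  have [lt_im|] := ltnP i m; last by exists [::].
  have allG : all (fun x => G <= count (P x) (strs i)) (Y i).
    apply/allP => x; rewrite mem_filter => /andP[/eqP lx _].
    by rewrite -lx; apply: hlev; rewrite lx.
  have [|F [szF Fs hF]] := greedy_hitting (k i) _ allG; first by rewrite size_strs expn_gt0.
  exists F => _; split=> //.
  case EY: (Y i) allG hF => [|x Yi] //= /andP[hG _]; rewrite size_strs.
  (* A nonempty class forces [G <= 2 ^ i], so [i] is at least [3n + 2 + l], which exceeds [a]. *)
  have le_ai : a <= i.
    have : G <= 2 ^ i by rewrite -size_strs (leq_trans hG) ?count_size.
    by rewrite leq_exp2l // /a; lia.
  (* This identity fixes the exponent of [G]: [k i] choices divide the class by at least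
     [2^(n+1)]. *)
  have -> : k i * G = 2 ^ n.+1 * 2 ^ i.
    by rewrite /k le_ai /G -!expnD; congr (2 ^ _); rewrite /a in le_ai *; lia.
  move: (_ + _) => R; rewrite mulnDr mulnA => hle.
  have : R * 2 ^ n.+1 * 2 ^ i <= (size Yi).+1 * 2 ^ i by apply: leq_trans hle; apply: leq_addl.
  by rewrite leq_pmul2r ?expn_gt0.
pose prog i (r : str) := (nseq n true ++ [:: false]) ++ (nth [::] (strs l) i ++ r).
pose As i := zip (map (prog i) (strs (i - a))) (F i).
pose A := flatten [seq As i | i <- iota 0 m].
have memA d : d \in A -> exists i r,
    [/\ i < m, a <= i, size r = i - a, d.1 = prog i r & d \in As i /\ size d.2 = i].
  move=> /flattenP[u /mapP[i im ->] hd].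
  have {im}lt_im : i < m by move: im; rewrite mem_iota.
  have [szF Fs _] := hF _ lt_im.
  have [/mapP[r]] := mem_zip hd; rewrite mem_strs => /eqP szr dE d2.
  exists i, r; split=> //; last by split=> //; apply/eqP; rewrite -mem_strs Fs.
  (* If [i < a], then [F i] would be empty, yet it contains [d.2]. *)
  by move: d2 szF; rewrite /k; case: leqP => // _; case: (F i).
have size_nth i : i < m -> size (nth [::] (strs l) i) = l.
  by move=> lt_im; apply/eqP; rewrite -mem_strs mem_nth // size_strs.
exists A; apply/and3P; split.
- apply/allP => d /memA[i [r [lt_im le_ai szr -> [_ ->]]]].
  rewrite prefix_prefix /prog !size_cat size_nseq size_nth //= szr.
  by rewrite /a in le_ai *; lia.
- apply/allP => d /memA[i [r [lt_im le_ai szr dE [dA _]]]].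
  apply/allP => d' /memA[i' [r' [lt_im' le_ai' szr' dE' [dA' _]]]].
  (* The blocks naming the lengths have equal size, so they agree and [i = i']; then [r] and [r']
     have equal size as well, and the programs coincide. *)
  apply/implyP; rewrite dE dE' /prog prefix_catl.
  move=> /prefix_cat_eqsize[]; first by rewrite !size_nth.
  move=> eq_nth pr; have eq_i : i = i'.
    apply/eqP; rewrite -(nth_uniq [::] _ _ (strs_uniq l)) ?size_strs //.
    exact/eqP.
  subst i'; move: pr; rewrite prefixE szr -szr' take_size => /eqP r_eq.
  apply/eqP/(zip_functional _ dA dA'); last by rewrite dE dE' r_eq.
  rewrite map_inj_uniq ?strs_uniq // => r1 r2 /eqP.
  by rewrite /prog !eqseq_cat // !eqxx /= => /eqP.
pose Q x := rich l G (P x) && ~~ has (fun d => P x d.2) A.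
have hQ x : Q x -> lev x < m.
  by rewrite /Q /rich has_find size_iota => /andP[].
rewrite -/Q (count_fibers _ hQ) -[2 ^ t]size_strs big_distrl /=.
have : count (fun x => lev x < m) (strs t) <= size (strs t) by apply: count_size.
apply: leq_trans; rewrite (count_fibers (lev := lev) (m := m)) //.
apply: leq_sum => i _; have lt_im := ltn_ord i.
have [szF _ hi] := hF _ lt_im.
rewrite (@eq_count _ (fun x => (lev x < m) && (lev x == i)) (fun x => lev x == i)); last first.
  by move=> x /=; case: eqP => [->|]; rewrite ?lt_im // andbF.
rewrite -[X in _ <= X]size_filter -/(Y i); apply: leq_trans hi.
rewrite leq_mul2r; apply/orP; right; rewrite count_filter; apply: sub_count => x /=.
case/andP => /andP[_ hno] ->; rewrite andbT; apply: contra hno => /hasP[s sF Ps].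
apply/hasP.
have : s \in unzip2 (As i).
  rewrite unzip2_zip // size_map size_strs szF /k.
  by case: ifP.
case/mapP => d dA sE; exists d; last by rewrite -sE.
by apply/flattenP; exists (As i) => //; apply/mapP; exists (val i); rewrite // mem_iota.
Qed.

(** * Compression when an element enters the halting set *)

(** The clause [n <= t] ensures that oracles of length at most [L] concern only finitely many [n],
    which bounds the union in the measure estimate. *)
Definition halts_by (n t : nat) : bool :=
  (n <= t) && proved (mkseq (fun=> false) t) t (fun f => (f.1 == n) && (f.2.1 == n)).

Lemma cpt_halts_by z : cpt2 z halts_by.
Proof.
rewrite /cpt2 /halts_by; refine (cpt_andb _ _); first by cpt_auto.
refine (cpt_proved _ _ _); rewrite /mkseq /cpt2; cpt_auto.
Qed.

Lemma halts_by_mono n t u : t <= u -> halts_by n t -> halts_by n u.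
Proof.
move=> le_tu /andP[le_nt h]; rewrite /halts_by (leq_trans le_nt le_tu) /=.
by apply: proved_mono h => //; apply: prefix_mkseq.
Qed.

Lemma haltingP n : halting n <-> exists t, halts_by n t.
Proof.
split=> [[c cE [v hv]]|[t /andP[_ /proved_sound[[e [m v]] /= /andP[/eqP eE /eqP mE] h]]]].
  have [|t0 ht0] := proved_complete (P := fun f => (f.1 == n) && (f.2.1 == n)) hv.
    by rewrite /= cE !eqxx.
  exists (maxn n t0); rewrite /halts_by leq_maxl /=.
  by apply: ht0; rewrite leq_maxr.
have [c cE] := code_num_surj n; exists c => //; exists v.
by rewrite -{1}mE; apply: h; rewrite /= eE.
Qed.

(** There is at most one such stage for each [n], so a single list of descriptions is ever used for
    [n]. *)
Definition first_stage (n t : nat) : bool :=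
  halts_by n t && all (fun u => ~~ halts_by n u) (iota 0 t).

Lemma cpt_first_stage z : cpt2 z first_stage.
Proof. by have h := cpt_halts_by z; rewrite /cpt2 /first_stage; cpt_auto. Qed.

Lemma first_stage_leq n t u : first_stage n t -> halts_by n u -> t <= u.
Proof.
case/andP => _ /allP h hu; rewrite leqNgt; apply/negP => lt_ut.
by have := h u; rewrite mem_iota lt_ut hu => /(_ isT).
Qed.

Lemma first_stage_uniq n t u : first_stage n t -> first_stage n u -> t = u.
Proof.
move=> ht hu; apply/eqP; rewrite eqn_leq (first_stage_leq ht) ?(first_stage_leq hu) //.
  by case/andP: ht.
by case/andP: hu.
Qed.

Lemma halting_first_stage n : halting n -> exists t, first_stage n t.
Proof.
move=> /haltingP ex; exists (ex_minn ex); case: ex_minnP => t ht hmin.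
apply/andP; split=> //; apply/allP => u; rewrite mem_iota /= add0n => lt_ut.
by apply/negP => /hmin; rewrite leqNgt lt_ut.
Qed.

(** Decoding passes through pairs of numbers because [enc] is not onto on strings, whereas
    [str_decode] inverts the bijection [str_code]. *)
Definition description_list (w : nat) : seq (str * str) :=
  map (fun q => (str_decode q.1, str_decode q.2)) (decode (enc_seq_surj enc_nat2_surj) w).

Lemma description_list_surj A : exists w, description_list w = A.
Proof.
exists (enc (map (fun d => (str_code d.1, str_code d.2)) A)).
rewrite /description_list encK -map_comp -[RHS]map_id; apply: eq_map => -[p s] /=.
by rewrite !str_codeK.
Qed.

Lemma cpt_description_list z : cpt z description_list.
Proof.
by have h := cpt_decode (enc_seq_surj enc_nat2_surj) z; rewrite /description_list; cpt_auto.
Qed.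

(** * Compression of the strings enumerated by the reduction *)

Section Compression.
Variables (phi : code) (lev : nat -> nat).
Hypothesis hlev : forall z, cpt z lev.

(** The length of [x] doubles as the stage, so the relation is decidable and grows along an
    oracle. *)
Definition outputs (x s : str) : bool :=
  proved x (size x) (pred1 (code_num phi, (str_code s, 1))).

Lemma cpt_outputs z : cpt2 z outputs.
Proof.
rewrite /cpt2 /outputs; refine (cpt_proved _ _ _); rewrite /cpt2; try by cpt_auto.
refine (cpt_eq _ _); first by cpt_auto.
refine (cpt_pair _ (cpt_pair (cpt_str_code _) _)); cpt_auto.
Qed.

Lemma outputs_mono x y s : prefix x y -> outputs x s -> outputs y s.
Proof. by move=> xy; apply: proved_mono => //; apply: size_prefix. Qed.

Definition rich_at (n : nat) (x : str) : bool :=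
  rich (lev n) (2 ^ (3 * n + 2 + lev n)) (outputs x).

Lemma cpt_rich_at z : cpt2 z rich_at.
Proof.
have ho := cpt_outputs z; have hl := hlev z.
by rewrite /cpt2 /rich_at /rich; cpt_auto.
Qed.

Lemma rich_at_mono n x y : prefix x y -> rich_at n x -> rich_at n y.
Proof.
move=> xy /hasP[i hi hG]; apply/hasP; exists i => //; apply: leq_trans hG _.
by apply: sub_count => s; apply: outputs_mono.
Qed.

Definition good (p : nat * nat) (w : nat) : bool :=
  good_descriptions p.1 p.2 (rich_at p.1) outputs (description_list w).

Lemma cpt_good z : cpt2 z good.
Proof.
have ho := cpt_outputs z; have hd := cpt_rich_at z; have hl := cpt_description_list z.
have hn : cpt z (fun n => nseq n true).
  have h : cpt z (fun n => nat_rect (fun=> str) [::] (fun _ r => true :: r) n) by cpt_auto.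
  by refine (cpt_ext _ h); elim=> //= n ->.
have hi : cpt2 z (fun d d' : str * str => prefix d.1 d'.1 ==> (d == d')).
  have h : cpt2 z (fun d d' : str * str => ~~ prefix d.1 d'.1 || (d == d')).
    by rewrite /cpt2; cpt_auto.
  by refine (cpt_ext _ h) => -[d d'] /=; rewrite implybE.
by rewrite /cpt2 /good /good_descriptions; cpt_auto.
Qed.

Lemma good_exists p : exists w, good p w.
Proof.
have [A hA] := exists_good_descriptions p.1 (lev p.1) p.2 outputs.
by have [w wE] := description_list_surj A; exists w; rewrite /good wE.
Qed.

(** The existence proof is classical, but goodness is decidable, so the least good index is found by
    search. *)
Definition descriptions (n t : nat) : seq (str * str) :=
  description_list (ex_minn (good_exists (n, t))).

Lemma cpt_descriptions z : cpt2 z descriptions.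
Proof.
rewrite /cpt2 /descriptions.
have h := cpt_ex_minn (cpt_good z) good_exists.
have h' := cpt_description_list z.
refine (cpt_comp h' _); refine (cpt_ext _ h) => -[n t] //.
Qed.

Lemma descriptionsP n t :
  good_descriptions n t (rich_at n) outputs (descriptions n t).
Proof. by rewrite /descriptions; case: ex_minnP. Qed.

(** The compression machine converges only on programs that occur in the list, so it never returns
    the default 0. *)
Definition lookup (p : str) (A : seq (str * str)) : nat :=
  foldr (fun d r => if d.1 == p then str_code d.2 else r) 0 A.

Lemma leading_ones_prefix n p : prefix (nseq n true ++ [:: false]) p -> leading_ones p = n.
Proof.
case/prefixP => q ->; rewrite /leading_ones.
by elim: n => //= n ->.
Qed.

Lemma descriptions_leading n t d : d \in descriptions n t -> leading_ones d.1 = n.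
Proof.
case/and3P: (descriptionsP n t) => /allP h _ _ /h /andP[h' _].
exact: leading_ones_prefix.
Qed.

Lemma descriptions_size n t d : d \in descriptions n t -> size d.1 + n <= size d.2.
Proof. by case/and3P: (descriptionsP n t) => /allP h _ _ /h /andP[]. Qed.

Lemma descriptions_prefix n t d d' :
  d \in descriptions n t -> d' \in descriptions n t -> prefix d.1 d'.1 -> d = d'.
Proof.
case/and3P: (descriptionsP n t) => _ /allP h _ /h /allP{}h /h /implyP{}h.
by move=> /h /eqP.
Qed.

Lemma lookup_descriptions n t d :
  d \in descriptions n t -> lookup d.1 (descriptions n t) = str_code d.2.
Proof.
move=> hd; have := fun d' => @descriptions_prefix n t d d' hd.
elim: (descriptions n t) hd => //= d' A IH; rewrite inE.
have [dd'|dd'] := eqVneq d.1 d'.1 => hd hA.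
  by rewrite -(hA d') ?mem_head // dd' prefix_refl.
apply: IH => [|d'' hd'']; last by apply: hA; rewrite inE hd'' orbT.
by case/orP: hd => // /eqP dE; rewrite dE eqxx in dd'.
Qed.

(* The program [p] determines [n] as its number of leading ones, and then
   waits until [n] is seen to halt. *)
Lemma compression_machine : exists2 M, prefix_free_machine M &
  forall n t d, first_stage n t -> d \in descriptions n t -> runs M d.1 d.2.
Proof.
pose z0 : Defs.real := fun=> false.
pose lo p := leading_ones (str_decode p).
pose Q p t := first_stage (lo p) t &&
  has (fun d => d.1 == str_decode p) (descriptions (lo p) t).
pose f p t := lookup (str_decode p) (descriptions (lo p) t).
have hs := cpt_first_stage z0; have hd := cpt_descriptions z0.
have hlo : cpt z0 lo by rewrite /lo; cpt_auto.
have hQ : cpt2 z0 Q by rewrite /cpt2 /Q; cpt_auto.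
have hf : cpt2 z0 f.
  rewrite /cpt2 /f /lookup; refine (cpt_foldr _ _ _); try by cpt_auto.
  refine (cpt_if _ (cpt_str_code _) _); cpt_auto.
have [M hM] := partial_search_code hQ hf.
have runsP p s : runs M p s <-> exists t,
    [/\ first_stage (leading_ones p) t,
        exists2 d, d \in descriptions (leading_ones p) t & d.1 = p &
        str_code s = lookup p (descriptions (leading_ones p) t)].
  rewrite /runs /eval0 (hM (str_code p)) /Q /f /lo str_codeK.
  split=> -[t].
    move=> [/andP[h1 /hasP[d hd' /eqP dE]] _ sE]; exists t; split=> //.
    by exists d.
  move=> [h1 [d hd' dE] sE]; exists t; split=> //.
    by rewrite h1; apply/hasP; exists d; rewrite ?dE.
  (* Minimality of [t] in the search is free, because the first stage is unique. *)
  move=> i lt_it; rewrite negb_and; apply/orP; left; apply/negP => hi.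
  by move: lt_it; rewrite (first_stage_uniq hi h1) ltnn.
exists M.
  move=> p q s s' /runsP[t [ht [d hd' dE] _]] /runsP[t' [ht' [d' hd'' dE'] _]] pq.
  (* A prefix of [q] beginning with [1^n 0] forces the same [n], hence the same stage and the same
     list. *)
  have lpq : leading_ones p = leading_ones q.
    case/and3P: (descriptionsP (leading_ones p) t) => /allP h _ _.
    have /andP[hp _] := h _ hd'; rewrite dE in hp.
    by rewrite (leading_ones_prefix (prefix_trans hp pq)).
  rewrite -lpq in ht' hd''.
  rewrite -(first_stage_uniq ht ht') in hd''.
  by rewrite -dE -dE' (descriptions_prefix hd' hd'') // dE dE'.
move=> n t d ht hd'; apply/runsP; exists t.
rewrite (descriptions_leading hd'); split=> //; first by exists d.
by rewrite lookup_descriptions.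
Qed.

(** * The Martin-Loef test of the missed oracles *)

Definition missed (n : nat) (x : str) : bool :=
  [&& first_stage n (size x), rich_at n x &
      ~~ has (fun d => outputs x d.2) (descriptions n (size x))].

Lemma cpt_missed z : cpt2 z missed.
Proof.
have hs := cpt_first_stage z; have hd := cpt_descriptions z.
have hr := cpt_rich_at z; have ho := cpt_outputs z.
by rewrite /cpt2 /missed; cpt_auto.
Qed.

(** The oracles missed for [n] have measure at most [2^-(n+1)], so this tail union has measure at
    most [2^-k]. *)
Definition missed_from (k : nat) : set str :=
  [set x | exists2 n, k <= n & missed n x].

Lemma missed_from_ce : uniformly_ce missed_from.
Proof.
pose z0 : Defs.real := fun=> false.
pose Q (p : nat * nat) n := (p.1 <= n) && missed n (str_decode p.2).
have hm := cpt_missed z0.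
have hQ : cpt2 z0 Q by rewrite /cpt2 /Q; cpt_auto.
have [c hc] := @search_code z0 _ _ Q hQ.
exists c => k s; rewrite (_ : npair _ _ = enc (k, str_code s)) // /eval0 -/z0.
split=> [[n le_kn hn]|[v /hc[/andP[le_kv hv] _]]]; last first.
  by exists v => //; move: hv; rewrite /= str_codeK.
have ex : exists n, Q (k, str_code s) n by exists n; rewrite /Q le_kn /= str_codeK.
exists (ex_minn ex); apply/hc; case: ex_minnP => v hv hmin; split=> // i lt_iv.
by apply/negP => /hmin; rewrite leqNgt lt_iv.
Qed.

Lemma count_take t L (Q : pred str) : t <= L ->
  count (fun u => Q (take t u)) (strs L) = count Q (strs t) * 2 ^ (L - t).
Proof.
elim: t L Q => [|t IH] L Q.
  move=> _; rewrite (eq_count (a2 := fun=> Q [::])); last by move=> u; rewrite take0.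
  rewrite subn0 -size_strs /= addn0.
  by case: (Q [::]); rewrite ?mul1n ?mul0n ?count_predT ?count_pred0.
case: L => //= L.
rewrite ltnS subSS => le_tL; rewrite !count_cat !count_map mulnDl.
by rewrite -!IH //; congr (_ + _); apply: eq_count.
Qed.

Lemma sub_in_count (T : eqType) (P Q : pred T) (s : seq T) :
  {in s, forall x, P x -> Q x} -> count P s <= count Q s.
Proof.
elim: s => //= x s IH h; rewrite leq_add ?IH //; last first.
  by move=> y ys; apply: h; rewrite inE ys orbT.
by have := h x (mem_head _ _); case: (P x) => // ->.
Qed.

(** Only the first stage [t] of [n] contributes; if [t <= L], the bound for length [t] is multiplied
    by the number [2^(L-t)] of extensions. *)
Lemma missed_count n L :
  count (fun u => has (fun t => missed n (take t u)) (iota 0 L.+1)) (strs L) * 2 ^ n.+1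
    <= 2 ^ L.
Proof.
have [[t [le_tL ht]]|no] := pselect (exists t, t <= L /\ first_stage n t); last first.
  rewrite (@eq_in_count _ _ pred0) ?count_pred0 // => u hu.
  apply/negbTE/negP => /hasP[t]; rewrite mem_iota /= add0n ltnS => le_tL /and3P[h _ _].
  apply: no; exists t; split=> //; move: h; rewrite size_takel //.
  by move: hu; rewrite mem_strs => /eqP->.
have -> : 2 ^ L = 2 ^ t * 2 ^ (L - t) by rewrite -expnD subnKC.
have /and3P[_ _] := descriptionsP n t.
set B := (X in count X _ * _ <= _) => hB.
apply: (@leq_trans (count B (strs t) * 2 ^ n.+1 * 2 ^ (L - t))); last first.
  by rewrite leq_mul2r hB orbT.
rewrite mulnAC -count_take // leq_mul2r; apply/orP; right.
apply: sub_in_count => u; rewrite mem_strs => szu /hasP[t'].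
rewrite mem_iota /= add0n ltnS => le_t'L.
case/and3P; rewrite size_takel ?(eqP szu) // => ht'.
by rewrite (first_stage_uniq ht' ht) /B => -> ->.
Qed.

(** Integer form of the bound of the sum of [2^-(k+j+1)] over [j < m] by [2^-k - 2^-(k+m)]. *)
Lemma geometric_sum (N : nat -> nat) k L m :
  (forall n, N n * 2 ^ n.+1 <= 2 ^ L) ->
  (\sum_(j < m) N (k + j)) * 2 ^ (k + m) + 2 ^ L <= 2 ^ L * 2 ^ m.
Proof.
move=> hN; elim: m => [|m IH]; first by rewrite big_ord0 muln1.
rewrite big_ord_recr /= mulnDl addnS; have := hN (k + m).
move: IH; rewrite !expnS; move: (\sum_(_ < _) _) (N _) (2 ^ L) (2 ^ (k + m)) (2 ^ m).
by move=> S a b p q; rewrite !(mulnCA _ 2 p) (mulnCA _ 2 q); lia.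
Qed.

Lemma missed_from_measure k : open_measure_le (missed_from k) (2 ^- k)%R.
Proof.
move=> L; rewrite /level_measure.
set card := #|_|.
suff le_card : card * 2 ^ k <= 2 ^ L.
  have pos j : (0 < 2 ^+ j :> rat)%R by rewrite exprn_gt0.
  rewrite ler_pdivrMr // mulrC ler_pdivlMr //.
  by rewrite -!natrX -natrM ler_nat.
pose N n := count (fun u => has (fun t => missed n (take t u)) (iota 0 L.+1)) (strs L).
have hN n : N n * 2 ^ n.+1 <= 2 ^ L by apply: missed_count.
suff le_sum : card <= \sum_(j < L.+1) N (k + j).
  have := geometric_sum k L.+1 hN; set S := \sum_(_ < _) _ in le_sum *.
  rewrite expnD => h; rewrite -(leq_pmul2r (expn_gt0 2 L.+1)).
  apply: leq_trans (leq_trans (leq_addr _ _) h).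
  by rewrite -mulnA leq_mul2r le_sum orbT.
have -> : card = count (fun u => `[< exists2 s, missed_from k s & prefix s u >]) (strs L).
  by rewrite count_strs.
apply: leq_trans (_ : count (fun u => has (fun j : 'I_L.+1 => has (fun t =>
    missed (k + j) (take t u)) (iota 0 L.+1)) (enum 'I_L.+1)) (strs L) <= _); last first.
  rewrite /N; elim: (strs L) => [|u s IH] /=; first by rewrite big1.
  rewrite big_split /= leq_add //; case: hasP => // -[j _ hj].
  by rewrite (bigD1 j) //= hj.
apply: sub_in_count => u; rewrite mem_strs => /eqP szu /asboolP[s [n le_kn hn] su].
have le_sL : size s <= L by rewrite -szu size_prefix.
(* By [halts_by], [n <= size s <= L], so the terms with index offset at most [L] suffice. *)
have lt_n : n - k < L.+1.
  case/and3P: hn => /andP[/andP[le_n _] _] _ _.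
  by rewrite ltnS (leq_trans (leq_subr _ _)) // (leq_trans le_n).
apply/hasP; exists (Ordinal lt_n); first by rewrite mem_enum.
apply/hasP; exists (size s); first by rewrite mem_iota add0n ltnS.
by move: su; rewrite prefixE /= subnKC // => /eqP->.
Qed.

End Compression.

(** * The reduction of the halting set to the random oracle *)

(** For [m = 2^l - 1] large, the limit gives [2^(3n+4) m < g m]; two of the extra bits pay for
    [2^l <= 4 m]. *)
Lemma level_exists (R : realType) (g : nat -> nat) :
  order_fun g ->
  ((n%:R / (g n)%:R : R)%R @[n --> \oo] --> (0 : R)%R) ->
  forall n, exists l, 2 ^ (3 * n + 2 + l) <= g (2 ^ l - 1).
Proof.
move=> [g_homo g_unb] g_lim n.
have eps_gt0 : (0 < (2 ^+ (3 * n + 4))^-1 :> R)%R by rewrite invr_gt0 exprn_gt0.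
move/cvgr0_norm_lt: g_lim => /(_ _ eps_gt0)[N _ hN].
have [M hM] := g_unb 1.
(* This puts [m] beyond [N], for the limit, and beyond [M], so that [g m] is positive and the
   quotient is a genuine one. *)
pose l := (N + M).+1; have lt_l : l < 2 ^ l by apply: ltn_expl.
pose m := 2 ^ l - 1.
have le_m : N + M <= m by rewrite /m /l in lt_l *; lia.
exists l; rewrite -/m.
have g_gt0 : 0 < g m by apply: leq_trans hM (g_homo _ _ _); lia.
have := hN m; rewrite /= => /(_ _); rewrite ger0_norm; last by rewrite divr_ge0.
have le_Nm : N <= m by lia.
move=> /(_ le_Nm); rewrite ltr_pdivrMr ?ltr0n // mulrC ltr_pdivlMr ?exprn_gt0 //.
rewrite -natrX -natrM ltr_nat => /ltnW; apply: leq_trans.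
have -> : 3 * n + 4 = 3 * n + 2 + 2 by lia.
rewrite (expnD 2 (3 * n + 2) l) (expnD 2 (3 * n + 2) 2); move: (2 ^ (3 * n + 2)) => e.
have le4m : 2 ^ l <= 4 * m by rewrite /m /l in lt_l *; lia.
apply: leq_trans (leq_mul (leqnn e) le4m) _.
by rewrite (_ : 2 ^ 2 = 4) //; nia.
Qed.

(** The finitely many deviating values are hardwired one at a time. This makes a reduction that is
    correct only for large arguments sufficient. *)
Lemma cpt_patch z (f h : nat -> nat) n0 :
  cpt z f -> (forall n, n0 <= n -> h n = f n) -> cpt z h.
Proof.
elim: n0 f => [|n0 IH] f hf hE; first by refine (cpt_ext _ hf) => n; rewrite hE.
apply: (IH (fun n => if n == n0 then h n0 else f n)); first by cpt_auto.
by move=> n; rewrite leq_eqVlt => /orP[/eqP<-|lt_n]; rewrite ?eqxx // gtn_eqF ?hE.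
Qed.

Lemma turing_le_cpt (A : set nat) z :
  cpt z (fun n => nat_of_bool `[< A n >]) -> turing_le A z.
Proof.
case=> c hc; exists c => n; have := hc n; rewrite /=.
by case: asboolP => // An h; split.
Qed.

(** * Enumeration of the fat set from the random oracle *)

Section Oracle.
Variables (z : Defs.real) (D : set str) (phi : code).
Hypothesis hphi : forall n, ((str_code @` D) n -> eval z phi n 1) /\
  (~ (str_code @` D) n -> eval z phi n 0).

Lemma outputs_sound t s : outputs phi (mkseq z t) s -> D s.
Proof.
move=> /proved_sound[f /eqP-> /(_ phi erefl)] /= h1.
apply: contrapT => nDs; have [_ h0] := hphi (str_code s).
have : eval z phi (str_code s) 0.
  by apply: h0 => -[s' Ds' /str_code_inj s's]; apply: nDs; rewrite -s's.
by move=> /(eval_fun h1).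
Qed.

Lemma outputs_complete s : D s ->
  exists t0, forall t, t0 <= t -> outputs phi (mkseq z t) s.
Proof.
move=> Ds; have [h1 _] := hphi (str_code s).
have [|t0 ht0] := proved_complete (P := pred1 (code_num phi, (str_code s, 1)))
    (h1 (ex_intro2 _ _ s Ds erefl)).
  exact: eqxx.
by exists t0 => t /ht0; rewrite /outputs size_mkseq.
Qed.

(** Fatness at [2 ^ lev n - 1] gives one length below [2 ^ lev n] with enough elements of [D]; they
    are finitely many, so a common stage outputs all of them. *)
Lemma rich_eventually (g lev : nat -> nat) n :
  fat g D -> 2 ^ (3 * n + 2 + lev n) <= g (2 ^ lev n - 1) ->
  exists t, rich_at phi lev n (mkseq z t).
Proof.
move=> hfat hlev.
pose F (i : 'I_(2 ^ lev n - 1).+1) := #|[pred t : i.-tuple bool | tval t \in D]|.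
have [|i iE] := bigop.eq_bigmax F; first by rewrite card_ord.
have le_card : g (2 ^ lev n - 1) <= F i by rewrite -iE; apply: hfat.
have /choice[t0 ht0] s : exists t0, D s -> forall t, t0 <= t -> outputs phi (mkseq z t) s.
  have [/outputs_complete[t0 ht0]|nDs] := pselect (D s); last by exists 0.
  by exists t0.
pose t := \max_(s <- strs i) t0 s.
exists t; apply/hasP; exists (val i).
  by rewrite mem_iota /= add0n (leq_trans (ltn_ord i)) // subn1 prednK ?expn_gt0.
apply: leq_trans hlev (leq_trans le_card _).
rewrite /F -(count_strs i (fun s => s \in D)); apply: sub_in_count => s hs; rewrite inE => Ds.
by apply: ht0 => //; rewrite /t (big_rem s) //= leq_maxl.
Qed.

End Oracle.

Theorem theorem1p2 (R : realType) (U : code) (g : nat -> nat) (z : real)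
    (D : set str) :
  optimal_machine U ->
  computable_fun g ->
  order_fun g ->
  ((n%:R / (g n)%:R : R)%R @[n --> \oo] --> (0 : R)%R) ->
  ML_random z ->
  str_turing_le D z ->
  fat g D ->
  incompressible U D ->
  turing_le halting z.
Proof.
move=> [_ U_opt] g_cpt g_ord g_lim z_random [phi hphi] D_fat [b D_incompr].
have level_ex := level_exists g_ord g_lim.
pose lev n := ex_minn (level_ex n).
have hlev y : cpt y lev.
  apply: (cpt_ex_minn (Q := fun n l => 2 ^ (3 * n + 2 + l) <= g (2 ^ l - 1))).
  have hg := computable_fun_cpt y g_cpt.
  by rewrite /cpt2; cpt_auto.
have lev_le n : 2 ^ (3 * n + 2 + lev n) <= g (2 ^ lev n - 1).
  by rewrite /lev; case: ex_minnP.
have rich_ex n := rich_eventually hphi D_fat (lev_le n).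
have [M M_pf M_runs] := compression_machine phi hlev.
have [d M_U] := U_opt M M_pf.
(* By optimality of [U], the compression by [n] bits survives up to the constant [d]. *)
have K_le n t ps : first_stage n t -> ps \in descriptions phi lev n t ->
    K U ps.2 + n <= size ps.2 + d.
  move=> ht hps; have [q Uq le_q] := M_U _ _ (M_runs _ _ _ ht hps).
  have : K U ps.2 <= size q.
    rewrite /K; case: pselect => [e|no]; last by [].
    by case: ex_minnP => m _; apply; apply/asboolP; exists q.
  move=> le_K; apply: leq_trans (leq_add (leq_trans le_K le_q) (leqnn n)) _.
  by rewrite addnAC leq_add2r; exact: descriptions_size hps.
have test : ML_test (missed_from phi lev).
  split; first exact: missed_from_ce.
  exact: missed_from_measure.
have [k hk] : exists k, ~ generated_open (missed_from phi lev k) z.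
  apply: contrapT => no; apply: (z_random _ test) => k _.
  by apply: contrapT => hk; apply: no; exists k.
have not_rich n t : maxn k (b + d).+1 <= n -> first_stage n t ->
    ~~ rich_at phi lev n (mkseq z t).
  rewrite geq_max => /andP[le_kn lt_n] ht; apply/negP => hr.
  (* Were [z] rich and not missed, some described string would be in [D]; incompressibility and
     [K_le] would then give [n <= b + d]. So [z] is missed, against the choice of [k]. *)
  apply: hk; exists t; exists n => //.
  rewrite /missed size_mkseq ht hr /=; apply/hasPn => ps hps.
  apply/negP => /(outputs_sound hphi) /D_incompr le_K.
  have := leq_trans (K_le _ _ _ ht hps) (leq_add le_K (leqnn d)).
  by rewrite -addnA leq_add2l leqNgt lt_n.
apply: turing_le_cpt.
(* The procedure waits until [z] is rich for [n] and asks whether [n] has been seen to halt by then;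
   it is right from the threshold of [not_rich] on. *)
apply: (@cpt_patch z (fun n => nat_of_bool (halts_by n (ex_minn (rich_ex n)))) _
          (maxn k (b + d).+1)).
  have hh := cpt_halts_by z; have hr := cpt_rich_at phi hlev z.
  have hz := cpt_mkseq z.
  have hQ : cpt2 z (fun n t => rich_at phi lev n (mkseq z t)).
    by rewrite /cpt2; cpt_auto.
  have he := cpt_ex_minn hQ rich_ex.
  by refine (cpt_nat_of_bool (cpt_comp2 hh cpt_id he)).
move=> n le_n; congr nat_of_bool; case: ex_minnP => t ht _.
apply/asboolP/idP => [/halting_first_stage[t' ht']|hn]; last by apply/haltingP; exists t.
(* Richness persists along [z], so a first halting stage at or after [t] would contradict
   [not_rich]. *)
have lt_t't : t' < t.
  rewrite ltnNge; apply/negP => le_tt'.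
  have := not_rich _ _ le_n ht'; rewrite (rich_at_mono _ ht) //.
  exact: prefix_mkseq.
by apply: halts_by_mono (ltnW lt_t't) _; case/andP: ht'.
Qed.
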